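(* Let $\nu\in\mathbb R\setminus\{\tfrac12,1\}$ and $\lambda\in\mathbb R$. Then the 2D Lamé–Navier operator $\mathfrak L_\nu$ is a two-sided golden differential transmutation of $\Delta^{\otimes 2}$ by the philosopher's stone $$\big(P,\;2\lambda_\nu R^*+\lambda\hat Q,\;R,\;2\lambda_\nu P^*+\lambda\hat S,\;T+\lambda\hat T,\;\tilde T+\lambda\check T\big),$$ where the operators $P,R,T,\tilde T,\hat Q,\hat S,\hat T,\check T$ and the constant $\lambda_\nu$ are those defined in the context and $^*$ denotes the formal adjoint.
   Context: All functions are on $\mathbb R^2$ with variable $x=(x_1,x_2)$, $x^\perp=(-x_2,x_1)$, and $\operatorname{rot}v=\partial_1v_2-\partial_2v_1$ for $v=(v_1,v_2)$. For $(u,p)\in C^\infty(\mathbb R^2;\mathbb R^2\times\mathbb R)$, $$\mathfrak L_\nu(u,p)=(\Delta u-\nabla p,\ \operatorname{div}u-\nu p),$$ and $\Delta^{\otimes2}(v_1,v_2)=(\Delta v_1,\Delta v_2)$ for $v\in C^\infty(\mathbb R^2;\mathbb R^2)$. Set $\lambda_\nu^{-1}:=4(1-2\nu)(1-\nu)$. For $v\in C^\infty(\mathbb R^2;\mathbb R^2)$: $$Pv:=\Big((1-2\nu)v-\tfrac12x\operatorname{div}v+\tfrac12x^\perp\operatorname{rot}v,\ -2\operatorname{div}v\Big),$$ $$Rv:=\Big((2-2\nu)v-\tfrac12x\operatorname{div}v+\tfrac12x^\perp\operatorname{rot}v,\ -\tfrac12x\cdot v\Big),$$ $$\tilde Tv:=\tfrac12\lambda_\nu|x|^2v,\qquad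 \check Tv:=\tfrac12(x\cdot v)x.$$ For $(u,p)\in C^\infty(\mathbb R^2;\mathbb R^2\times\mathbb R)$: $$T(u,p):=4\lambda_\nu\Big(\tfrac12px+\tfrac18u|x|^2,\ (3-2\nu)p+\tfrac12x\cdot u\Big),$$ $$\hat Q(u,p):=x\operatorname{div}u-\nu px,\qquad \hat S(u,p):=x\Delta p+2\nabla p,$$ $$\hat T(u,p):=\Big(\tfrac12|x|^2\nabla p+2\nu px,\ 4p+2x\cdot\nabla p\Big).$$ The formal adjoint of $\sum_\alpha C_\alpha(x)\partial^\alpha$ (with matrix-valued coefficients) is the operator $A^*$ characterized by $\langle Au,v\rangle_{L^2}=\langle u,A^*v\rangle_{L^2}$ for all compactly supported smooth $u,v$. For linear differential operators with smooth coefficients $A:\mathcal E\to\mathcal F$, $B:\mathcal G\to\mathcal H$ between spaces of smooth vector-valued functions, $A$ is a two-sided golden differential transmutation of $B$ by $(P,Q,R,S,T,\tilde T)$ if $P:\mathcal G\to\mathcal E$, $Q:\mathcal E\to\mathcal G$, $R:\mathcal H\to\mathcal F$, $S:\mathcal F\to\mathcal H$, $T:\mathcal F\to\mathcal E$, $\tilde T:\mathcal H\to\mathcal G$ are linear differential operators with smooth coefficients and $AP=RB$, $BQ=SA$, $PQ+TA=\mathrm{Id}_{\mathcal E}$, $RS+AT=\mathrm{Id}_{\mathcal F}$, $QP+\tilde TB=\mathrm{Id}_{\mathcal G}$, $SR+B\tilde T=\mathrm{Id}_{\mathcal H}$. Here $\mathcal E=\mathcal F=C^\infty(\mathbb R^2;\mathbb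 R^2\times\mathbb R)$ and $\mathcal G=\mathcal H=C^\infty(\mathbb R^2;\mathbb R^2)$. *)

(* Defs.v *)
From HB Require Import structures.
From mathcomp Require Import all_boot all_order all_algebra.
From mathcomp Require Import all_classical all_reals all_analysis.

Set Implicit Arguments.
Unset Strict Implicit.
Unset Printing Implicit Defensive.

Import Order.TTheory GRing.Theory Num.Theory.
Import numFieldNormedType.Exports.

Local Open Scope classical_set_scope.
Local Open Scope ring_scope.

(** * Smooth functions on the plane *)

Section PlanarOperators.
Variable R : realType.

Definition sfun : Type := R * R -> R.
Definition vfun (n : nat) : Type := R * R -> 'cV[R]_n.

Definition basis_vec (i : 'I_2) : R * R := if i == 0 then (1, 0) else (0, 1).

Definition pderiv (i : 'I_2) (f : sfun) : sfun := fun x => 'D_(basis_vec i) f x.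

(** C^oo: every iterated partial derivative, along any word of directions,
    exists and is continuous. *)
Definition smooth (f : sfun) : Prop :=
  forall s : seq 'I_2,
    continuous (foldr pderiv f s) /\
    forall (i : 'I_2) (x : R * R), derivable (foldr pderiv f s) x (basis_vec i).

Definition vcomp n (u : vfun n) (k : 'I_n) : sfun := fun x => u x k 0.

Definition vsmooth n (u : vfun n) : Prop := forall k, smooth (vcomp u k).

(** [mderiv a b u] is the multi-index derivative of order (a, b), taken
    componentwise. *)
Definition mderiv n (a b : nat) (u : vfun n) : vfun n :=
  fun x => \col_k iter a (pderiv 0) (iter b (pderiv 1) (vcomp u k)) x.

(** Operators are total on [vfun]; their values matter on smooth functions only,
    and all identities between them are required on smooth functions only. *)
Definition diff_op m n (A : vfun m -> vfun n) : Prop :=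
  exists (N : nat) (C : nat -> nat -> R * R -> 'M[R]_(n, m)),
    (forall a b i j, smooth (fun x => C a b x i j)) /\
    forall u, vsmooth u -> forall x,
      A u x = \sum_(a < N) \sum_(b < N) C a b x *m mderiv a b u x.

Definition vdot n (u v : vfun n) : sfun :=
  fun x => \sum_(k < n) u x k 0 * v x k 0.

Definition L2_inner n (u v : vfun n) : R :=
  \int[(@lebesgue_measure R \x @lebesgue_measure R)%E]_x vdot u v x.

Definition test_fun n (u : vfun n) : Prop :=
  vsmooth u /\ compact (closure [set x | u x != 0]).

Definition is_formal_adjoint m n (A : vfun m -> vfun n) (B : vfun n -> vfun m)
    : Prop :=
  diff_op B /\
  forall u v, test_fun u -> test_fun v -> L2_inner (A u) v = L2_inner u (B v).

(** The differential operator characterized by [is_formal_adjoint A]; its values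
    on smooth functions do not depend on the choice made by [get]. *)
Definition formal_adjoint m n (A : vfun m -> vfun n) : vfun n -> vfun m :=
  get [set B | is_formal_adjoint A B].

Record two_sided_golden_transmutation e f g h
    (A : vfun e -> vfun f) (B : vfun g -> vfun h)
    (P : vfun g -> vfun e) (Q : vfun e -> vfun g)
    (R' : vfun h -> vfun f) (S : vfun f -> vfun h)
    (T : vfun f -> vfun e) (T' : vfun h -> vfun g) : Prop := {
  golden_diff_A : diff_op A;
  golden_diff_B : diff_op B;
  golden_diff_P : diff_op P;
  golden_diff_Q : diff_op Q;
  golden_diff_R : diff_op R';
  golden_diff_S : diff_op S;
  golden_diff_T : diff_op T;
  golden_diff_T' : diff_op T';
  golden_AP : forall v, vsmooth v -> A (P v) = R' (B v);
  golden_BQ : forall w, vsmooth w -> B (Q w) = S (A w);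
  golden_PQ : forall w, vsmooth w -> P (Q w) + T (A w) = w;
  golden_RS : forall w, vsmooth w -> R' (S w) + A (T w) = w;
  golden_QP : forall v, vsmooth v -> Q (P v) + T' (B v) = v;
  golden_SR : forall v, vsmooth v -> S (R' v) + B (T' v) = v
}.

(** * Vector calculus in the plane *)

Definition pos : vfun 2 := fun x => \col_i (if i == 0 then x.1 else x.2).
Definition pos_perp : vfun 2 := fun x => \col_i (if i == 0 then - x.2 else x.1).

Definition grad (p : sfun) : vfun 2 := fun x => \col_i pderiv i p x.
Definition laplacian (f : sfun) : sfun :=
  fun x => pderiv 0 (pderiv 0 f) x + pderiv 1 (pderiv 1 f) x.
Definition vlaplacian n (u : vfun n) : vfun n :=
  fun x => \col_k laplacian (vcomp u k) x.
Definition divergence (u : vfun 2) : sfun :=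
  fun x => pderiv 0 (vcomp u 0) x + pderiv 1 (vcomp u 1) x.
Definition rot (v : vfun 2) : sfun :=
  fun x => pderiv 0 (vcomp v 1) x - pderiv 1 (vcomp v 0) x.

(** A pair (u, p) with values in R^2 x R is a [vfun (2 + 1)]. *)
Definition vpair (u : vfun 2) (p : sfun) : vfun (2 + 1) :=
  fun x => col_mx (u x) (p x)%:M.
Definition vel (w : vfun (2 + 1)) : vfun 2 := fun x => usubmx (w x).
Definition pres (w : vfun (2 + 1)) : sfun := fun x => dsubmx (w x) 0 0.

(** * The Lame-Navier operator and its philosopher's stone *)

Variable nu : R.

Definition lambda_nu : R := (4 * (1 - 2 * nu) * (1 - nu))^-1.

Definition lame_navier (w : vfun (2 + 1)) : vfun (2 + 1) :=
  let u := vel w in let p := pres w in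
  vpair (fun x => vlaplacian u x - grad p x) (fun x => divergence u x - nu * p x).

Definition opP (v : vfun 2) : vfun (2 + 1) :=
  vpair (fun x => (1 - 2 * nu) *: v x - (2^-1 * divergence v x) *: pos x
                  + (2^-1 * rot v x) *: pos_perp x)
        (fun x => - 2 * divergence v x).

Definition opR (v : vfun 2) : vfun (2 + 1) :=
  vpair (fun x => (2 - 2 * nu) *: v x - (2^-1 * divergence v x) *: pos x
                  + (2^-1 * rot v x) *: pos_perp x)
        (fun x => - 2^-1 * vdot pos v x).

Definition opTtilde (v : vfun 2) : vfun 2 :=
  fun x => (2^-1 * lambda_nu * vdot pos pos x) *: v x.

Definition opTcheck (v : vfun 2) : vfun 2 :=
  fun x => (2^-1 * vdot pos v x) *: pos x.

Definition opT (w : vfun (2 + 1)) : vfun (2 + 1) :=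
  let u := vel w in let p := pres w in
  (4 * lambda_nu) *:
    vpair (fun x => (2^-1 * p x) *: pos x + (8^-1 * vdot pos pos x) *: u x)
          (fun x => (3 - 2 * nu) * p x + 2^-1 * vdot pos u x).

Definition opQhat (w : vfun (2 + 1)) : vfun 2 :=
  let u := vel w in let p := pres w in
  fun x => divergence u x *: pos x - (nu * p x) *: pos x.

Definition opShat (w : vfun (2 + 1)) : vfun 2 :=
  let p := pres w in
  fun x => laplacian p x *: pos x + 2 *: grad p x.

Definition opThat (w : vfun (2 + 1)) : vfun (2 + 1) :=
  let p := pres w in
  vpair (fun x => (2^-1 * vdot pos pos x) *: grad p x + (2 * nu * p x) *: pos x)
        (fun x => 4 * p x + 2 * vdot pos (grad p) x).

End PlanarOperators.

(* Main.v *)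
Require Import Defs.
From mathcomp Require Import all_boot all_order all_algebra.
From mathcomp Require Import all_classical all_reals all_analysis.
From mathcomp Require Import measurable_realfun ring lra.

Set Implicit Arguments.
Unset Strict Implicit.
Unset Printing Implicit Defensive.

(**
  All the operators of the statement have polynomial coefficients.  Up to the two
  formal adjoints, the six identities are therefore identities between matrices
  over the Weyl algebra: an operator is stored as a list of terms
  c x1^m x2^n d1^a d2^b u_k, composition is computed by the Leibniz rule (and the
  symmetry of second derivatives), and the resulting coefficients are compared as
  rational functions of nu.

  P and R are both of the form
    v |-> (al v - x div v / 2 + x^perp rot v / 2, be div v + ga x.v),
  whose formal adjoint is
    (u, p) |-> al u + x div u / 2 - x^perp rot u / 2 - be grad p + ga p x,
  because the difference of the two pointwise pairings is the divergence of a
  compactly supported field.  A formal adjoint is unique: on test functions since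
  the pairing is definite, and on all smooth functions since a differential
  operator is local and smooth cut-off functions exist.
*)

Import Order.TTheory GRing.Theory Num.Theory.
Import numFieldNormedType.Exports.
Local Open Scope classical_set_scope.
Local Open Scope ring_scope.

(** * Smooth functions on the plane *)

Section Smooth.
Variable R : realType.
Implicit Types (f g : R * R -> R) (x : R * R) (i : 'I_2).

Lemma ord2P i : i = 0 \/ i = 1.
Proof. by case: i => [[|[|//]] lti]; [left|right]; apply/val_inj. Qed.

Lemma basis_vec0 : @basis_vec R 0 = (1, 0). Proof. by []. Qed.
Lemma basis_vec1 : @basis_vec R 1 = (0, 1). Proof. by []. Qed.

(** Equating the difference quotients as functions of h, rather than their limits, transfers both
    derivability and the value of the derivative to one-variable slices. *)
Lemma diff_quot_fst f (a b : R) :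
  (fun h : R => h^-1 *: ((f \o shift (a, b)) (h *: ((1, 0) : R * R)) - f (a, b))) =
  (fun h : R => h^-1 *: (((fun t => f (t, b)) \o shift a) (h *: 1) - f (a, b))).
Proof.
apply/funext => h /=; congr (_ *: (f _ - _)).
by rewrite /GRing.add /= /GRing.scale /= /add_pair /scale_pair/= scaler0 add0r.
Qed.

Lemma diff_quot_snd f (a b : R) :
  (fun h : R => h^-1 *: ((f \o shift (a, b)) (h *: ((0, 1) : R * R)) - f (a, b))) =
  (fun h : R => h^-1 *: (((fun t => f (a, t)) \o shift b) (h *: 1) - f (a, b))).
Proof.
apply/funext => h /=; congr (_ *: (f _ - _)).
by rewrite /GRing.add /= /GRing.scale /= /add_pair /scale_pair/= scaler0 add0r.
Qed.

Lemma derivable_fst f (a b : R) :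
  derivable f (a, b) (basis_vec R 0) <-> derivable (fun t => f (t, b)) a 1.
Proof. by rewrite /derivable basis_vec0 diff_quot_fst. Qed.

Lemma derivable_snd f (a b : R) :
  derivable f (a, b) (basis_vec R 1) <-> derivable (fun t => f (a, t)) b 1.
Proof. by rewrite /derivable basis_vec1 diff_quot_snd. Qed.

Lemma pderiv_fst f (a b : R) : pderiv 0 f (a, b) = 'D_1 (fun t => f (t, b)) a.
Proof. by rewrite /pderiv /derive basis_vec0 diff_quot_fst. Qed.

Lemma pderiv_snd f (a b : R) : pderiv 1 f (a, b) = 'D_1 (fun t => f (a, t)) b.
Proof. by rewrite /pderiv /derive basis_vec1 diff_quot_snd. Qed.

(** C^n by recursion on the order, peeling off the derivative that is applied first. Products and
    compositions are handled by induction on n, for which the words of directions in [smooth] are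
    inconvenient. *)
Fixpoint contdiff (n : nat) f : Prop :=
  if n is n'.+1 then
    [/\ continuous f, forall i x, derivable f x (basis_vec R i)
      & forall i, contdiff n' (pderiv i f)]
  else continuous f.

Lemma contdiffW n f : contdiff n.+1 f -> contdiff n f.
Proof.
elim: n f => [|n IHn] f; first by case.
by move=> [cf df pf]; split=> // i; apply: IHn; exact: pf.
Qed.

Lemma smooth_continuous f : smooth f -> continuous f.
Proof. by move=> /(_ [::])[]. Qed.

Lemma smooth_derivable f i x : smooth f -> derivable f x (basis_vec R i).
Proof. by move=> /(_ [::])[_]; apply. Qed.

(** [foldr] applies the last letter of a word first, so a word acting on [pderiv i f] is that word
    with i appended, acting on f. *)
Lemma smooth_pderiv f i : smooth f -> smooth (pderiv i f).
Proof. by move=> sf s; have := sf (rcons s i); rewrite foldr_rcons. Qed.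

Lemma smoothP f : smooth f <-> forall n, contdiff n f.
Proof.
split=> [sf n|cf s].
  elim: n f sf => [|n IHn] f sf; first exact: smooth_continuous.
  split=> [|i x|i]; [exact: smooth_continuous|exact: smooth_derivable|].
  exact/IHn/smooth_pderiv.
have {}cf n : contdiff n (foldr (@pderiv R) f s).
  elim: s n => [|i s IHs] n; first exact: cf.
  by have [_ _] := IHs n.+1; apply.
by split=> [|i x]; [exact: (cf 0%N)|have [_ df _] := cf 1%N; exact: df].
Qed.

Lemma pderivD i f g : (forall x, derivable f x (basis_vec R i)) ->
  (forall x, derivable g x (basis_vec R i)) ->
  pderiv i (fun x => f x + g x) = (fun x => pderiv i f x + pderiv i g x).
Proof. by move=> df dg; apply/funext => x; exact: deriveD. Qed.

Lemma pderivM i f g : (forall x, derivable f x (basis_vec R i)) ->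
  (forall x, derivable g x (basis_vec R i)) ->
  pderiv i (fun x => f x * g x) =
  (fun x => f x * pderiv i g x + g x * pderiv i f x).
Proof. by move=> df dg; apply/funext => x; exact: deriveM. Qed.

Lemma pderiv_cst i (c : R) : pderiv i (fun=> c) = fun=> 0.
Proof. by apply/funext => x; exact: derive_cst. Qed.

Lemma derivable_coord1 i x : derivable (fun x : R * R => x.1) x (basis_vec R i).
Proof.
case: x => a b; case: (ord2P i) => ->.
- by apply/derivable_fst; exact: derivable_id.
- by apply/derivable_snd; exact: derivable_cst.
Qed.

Lemma derivable_coord2 i x : derivable (fun x : R * R => x.2) x (basis_vec R i).
Proof.
case: x => a b; case: (ord2P i) => ->.
- by apply/derivable_fst; exact: derivable_cst.
- by apply/derivable_snd; exact: derivable_id.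
Qed.

Lemma pderiv_coord1 i : pderiv i (fun x : R * R => x.1) = fun=> (i == 0)%:R.
Proof.
apply/funext => -[a b]; case: (ord2P i) => ->.
- by rewrite pderiv_fst/= derive_id.
- by rewrite pderiv_snd/= derive_cst.
Qed.

Lemma pderiv_coord2 i : pderiv i (fun x : R * R => x.2) = fun=> (i == 1)%:R.
Proof.
apply/funext => -[a b]; case: (ord2P i) => ->.
- by rewrite pderiv_fst/= derive_cst.
- by rewrite pderiv_snd/= derive_id.
Qed.

Lemma contdiff_cst n (c : R) : contdiff n (fun=> c).
Proof.
elim: n c => [|n IHn] c /=; first by move=> x; exact: cvg_cst.
split; first by move=> x; exact: cvg_cst.
- by move=> i x; exact: derivable_cst.
- by move=> i; rewrite pderiv_cst; exact: IHn.
Qed.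

Lemma contdiffD n f g : contdiff n f -> contdiff n g -> contdiff n (fun x => f x + g x).
Proof.
elim: n f g => [|n IHn] f g /=.
  by move=> cf cg x; apply: cvgD; [exact: cf|exact: cg].
move=> [cf df pf] [cg dg pg]; split.
- by move=> x; apply: cvgD; [exact: cf|exact: cg].
- by move=> i x; apply: derivableD; [exact: df|exact: dg].
- by move=> i; rewrite pderivD //; exact: IHn.
Qed.

Lemma contdiffM n f g : contdiff n f -> contdiff n g -> contdiff n (fun x => f x * g x).
Proof.
elim: n f g => [|n IHn] f g; first by move=> cf cg x; apply: cvgM; [exact: cf|exact: cg].
move=> cf cg; have [cf0 df pf] := cf; have [cg0 dg pg] := cg; split.
- by move=> x; apply: cvgM; [exact: cf0|exact: cg0].
- by move=> i x; apply: derivableM; [exact: df|exact: dg].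
- move=> i; rewrite pderivM //.
  (* The undifferentiated factor of each Leibniz product has one order to spare, which [contdiffW]
     drops. *)
  by apply: contdiffD; apply: IHn; [exact: contdiffW|exact: pg|exact: contdiffW|exact: pf].
Qed.

Lemma smooth_cst (c : R) : smooth (fun=> c).
Proof. by apply/smoothP => n; exact: contdiff_cst. Qed.

Lemma smoothD f g : smooth f -> smooth g -> smooth (fun x => f x + g x).
Proof. by move=> /smoothP sf /smoothP sg; apply/smoothP => n; exact: contdiffD. Qed.

Lemma smoothM f g : smooth f -> smooth g -> smooth (fun x => f x * g x).
Proof. by move=> /smoothP sf /smoothP sg; apply/smoothP => n; exact: contdiffM. Qed.

Lemma smooth_coord1 : smooth (fun x : R * R => x.1).
Proof.
apply/smoothP => -[|n] /=; first by move=> x; exact: cvg_fst.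
split; [by move=> x; exact: cvg_fst|exact: derivable_coord1|].
by move=> i; rewrite pderiv_coord1; exact: contdiff_cst.
Qed.

Lemma smooth_coord2 : smooth (fun x : R * R => x.2).
Proof.
apply/smoothP => -[|n] /=; first by move=> x; exact: cvg_snd.
split; [by move=> x; exact: cvg_snd|exact: derivable_coord2|].
by move=> i; rewrite pderiv_coord2; exact: contdiff_cst.
Qed.

Lemma smoothX f n : smooth f -> smooth (fun x => f x ^+ n).
Proof.
move=> sf; elim: n => [|n IHn]; first exact: smooth_cst.
under eq_fun do rewrite exprS.
exact: smoothM sf IHn.
Qed.

Lemma smooth_sum (I : Type) (s : seq I) (F : I -> R * R -> R) :
  (forall t, smooth (F t)) -> smooth (fun x => \sum_(t <- s) F t x).
Proof.
move=> sF; elim: s => [|t s IHs].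
  by under eq_fun do rewrite big_nil; exact: smooth_cst.
under eq_fun do rewrite big_cons.
exact: smoothD (sF t) IHs.
Qed.

Lemma smooth_iter f i n : smooth f -> smooth (iter n (@pderiv R i) f).
Proof. by move=> sf; elim: n => [//|n IHn] /=; exact: smooth_pderiv. Qed.

End Smooth.

(** * Symmetry of second derivatives and locality of differentiation *)

Section Schwarz.
Variable R : realType.
Implicit Types (f g : R * R -> R) (x : R * R) (i : 'I_2).

Lemma MVT_derivable (f : R -> R) (a b : R) : a < b ->
  (forall t, derivable f t 1) ->
  exists2 c, c \in `]a, b[ & f b - f a = 'D_1 f c * (b - a).
Proof.
move=> ab df; apply: (@MVT R f ('D_1 f)) => //.
by apply: derivable_within_continuous => t tab; exact: df.
Qed.

(** The mixed second difference over a square; its invariance under exchange of the two coordinates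
    is the source of the symmetry of second derivatives. *)
Definition rect_diff f (a b h : R) :=
  (f (a + h, b + h) - f (a, b + h)) - (f (a + h, b) - f (a, b)).

(** Two uses of the mean value theorem: on [f (t, b + h) - f (t, b)] as a function of t, which
    yields s, then on [pderiv 0 f (s, t)] as a function of t. *)
Lemma rect_diff_pderiv f (a b h : R) : 0 < h ->
  (forall x, derivable f x (basis_vec R 0)) ->
  (forall x, derivable (pderiv 0 f) x (basis_vec R 1)) ->
  exists s t, [/\ s \in `]a, a + h[, t \in `]b, b + h[
    & rect_diff f a b h = pderiv 1 (pderiv 0 f) (s, t) * h * h].
Proof.
move=> h0 df ddf.
have dfst c t : derivable (fun t => f (t, c)) t 1 by apply/derivable_fst.
have [||s sab] := @MVT_derivable (fun t => f (t, b + h) - f (t, b)) a (a + h).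
- by rewrite ltrDl.
- by move=> t; apply: derivableB.
rewrite deriveB // -!pderiv_fst [a + h - a]addrC addKr => E.
have [||t tab E'] :=
  @MVT_derivable (fun t => pderiv 0 f (s, t)) b (b + h).
- by rewrite ltrDl.
- by move=> t; apply/derivable_snd.
exists s, t; split=> //.
rewrite /rect_diff pderiv_snd.
rewrite [b + h - b]addrC addKr in E'.
rewrite -E' -E; ring.
Qed.

Let itv_ball (u c h d : R) : h < d -> u \in `]c, c + h[ -> ball c d u.
Proof.
move=> hd; rewrite in_itv /= => /andP[cu uc]; rewrite /ball /= ltr_distlC.
by apply/andP; split; lra.
Qed.

Let ler_dist_half (u v w e : R) :
  `|u - w| < e / 2 -> `|v - w| < e / 2 -> `|u - v| <= e.
Proof.
rewrite !ltr_norml ler_norml => /andP[? ?] /andP[? ?].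
by apply/andP; split; lra.
Qed.

(** The second difference of f and that of f with swapped coordinates coincide, so the two mixed
    derivatives take a common value at two points of an arbitrarily small square at (a, b).
    Continuity then brings their values at (a, b) within any e of each other. *)
Lemma pderivC f : smooth f -> pderiv 0 (pderiv 1 f) = pderiv 1 (pderiv 0 f).
Proof.
move=> sf.
have cont i j : continuous (pderiv i (pderiv j f)).
  exact/smooth_continuous/smooth_pderiv/smooth_pderiv.
apply/funext => -[a b]; apply/eqP; rewrite -subr_eq0 -normr_le0.
apply/ler_addgt0Pl => e e0; rewrite addr0.
have e20 : 0 < e / 2 by rewrite divr_gt0.
pose close i j := [set p |
  `|pderiv i (pderiv j f) (a, b) - pderiv i (pderiv j f) p| < e / 2].
have near_pt i j : nbhs (a, b) (close i j).
  by have /cvgrPdist_lt /(_ _ e20) := cont i j (a, b).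
have /nbhs_ballP[d /= d0 dP] : nbhs (a, b) (close 0 1 `&` close 1 0).
  by apply: filterI; exact: near_pt.
pose h := d / 2; have h0 : 0 < h by rewrite divr_gt0.
have hd : h < d by rewrite /h; lra.
have [||s [t [sa tb E]]] := @rect_diff_pderiv f a b h h0.
- by move=> x; exact: smooth_derivable.
- by move=> x; apply/smooth_derivable/smooth_pderiv.
have p0 : pderiv 0 (fun x : R * R => f (x.2, x.1)) =
    fun x => pderiv 1 f (x.2, x.1).
  by apply/funext => -[u v]; rewrite pderiv_fst pderiv_snd.
have [||t' [s' [tb' sa' E']]] :=
  @rect_diff_pderiv (fun x => f (x.2, x.1)) b a h h0.
- move=> [u v]; apply/derivable_fst => /=.
  exact: ((derivable_snd f v u).1 (smooth_derivable sf)).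
- move=> [u v]; rewrite p0; apply/derivable_snd => /=.
  have sf1 : smooth (pderiv 1 f) by exact: smooth_pderiv.
  exact: ((derivable_fst (pderiv 1 f) v u).1 (smooth_derivable sf1)).
(* Both sides times h * h are the same second difference, and h is nonzero. *)
have E2 : pderiv 0 (pderiv 1 f) (s', t') = pderiv 1 (pderiv 0 f) (s, t).
  have E'' : pderiv 1 (pderiv 0 (fun x : R * R => f (x.2, x.1))) (t', s') =
      pderiv 0 (pderiv 1 f) (s', t').
    by rewrite p0 [LHS]pderiv_snd [RHS]pderiv_fst.
  have S : rect_diff (fun x => f (x.2, x.1)) b a h = rect_diff f a b h.
    by rewrite /rect_diff /=; ring.
  rewrite E'' S in E'.
  move: E E'; move: (pderiv 0 _ _) (pderiv 1 _ _) (rect_diff _ _ _ _).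
  move=> A B r -> /(mulIf (lt0r_neq0 h0)) /(mulIf (lt0r_neq0 h0)).
  by move=> ->.
have [A1 _] : (close 0 1 `&` close 1 0) (s', t').
  by apply: dP; split; [exact: itv_ball sa'|exact: itv_ball tb'].
have [_ A2] : (close 0 1 `&` close 1 0) (s, t).
  by apply: dP; split; [exact: itv_ball sa|exact: itv_ball tb].
by move: A1 A2; rewrite /close /= E2; exact: ler_dist_half.
Qed.

(** This brings iterated derivatives to the normal order, with those in the first variable
    outermost. *)
Lemma pderiv1_iter0 f n : smooth f ->
  pderiv 1 (iter n (@pderiv R 0) f) = iter n (@pderiv R 0) (pderiv 1 f).
Proof.
move=> sf; elim: n => [//|n IHn] /=.
by rewrite -[LHS]pderivC; [rewrite IHn|exact: smooth_iter].
Qed.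

Lemma near_pderiv f g i x : (\forall y \near x, f y = g y) ->
  \forall y \near x, pderiv i f y = pderiv i g y.
Proof.
by move=> /near_join fg; near=> y; apply: near_eq_derive; near: y.
Unshelve. all: by end_near. Qed.

Lemma near_iter_pderiv f g i n x : (\forall y \near x, f y = g y) ->
  \forall y \near x, iter n (@pderiv R i) f y = iter n (@pderiv R i) g y.
Proof. by move=> fg; elim: n => [//|n IHn] /=; exact: near_pderiv. Qed.

End Schwarz.

(** * Integration on the plane *)

Section PlaneIntegral.
Variable R : realType.
Local Notation plane := (measurableTypeR R * measurableTypeR R)%type.
Local Notation mu2 := (@lebesgue_measure R \x @lebesgue_measure R)%E.
Implicit Types (f g : R * R -> R) (x : R * R) (M : R).

Let inb (x a b d : R) : x - d < a -> b < x + d ->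
  [set` `]a, b[] `<=` ball x d.
Proof.
move=> xa bx t; rewrite /= in_itv /= => /andP[? ?]; rewrite /ball /= ltr_distlC.
by apply/andP; split; lra.
Qed.

Let rat_box (x d : R) : 0 < d -> exists p q : rat,
  [/\ ratr p < x, x < ratr q & [set` `](ratr p : R), ratr q[] `<=` ball x d].
Proof.
move=> d0.
have [p] := @rat_in_itvoo R (x - d) x ltac:(by rewrite ltrBlDr ltrDl).
rewrite in_itv /= => /andP[xp px].
have [q] := @rat_in_itvoo R x (x + d) ltac:(by rewrite ltrDl).
rewrite in_itv /= => /andP[xq qx].
by exists p, q; split => //; exact: inb.
Qed.

(** Measurability is for the product sigma-algebra, which is generated by rectangles: an open set is
    the union of the countably many rational boxes inside it. *)
Lemma open_plane_measurable (A : set plane) : open (A : set (R * R)) -> measurable A.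
Proof.
move=> oA.
pose box (r : (rat * rat) * (rat * rat)) : set plane :=
  [set` `](ratr r.1.1 : R), ratr r.1.2[] `*` [set` `](ratr r.2.1 : R), ratr r.2.2[].
(* The index runs over all quadruples of rationals; boxes that leave A are replaced by the empty
   set. *)
have -> : A = \bigcup_r (if pselect (box r `<=` A) then box r else set0).
  apply/seteqP; split=> [[x y] Axy|x [r _]]; last first.
  by case: pselect => [rA|//] /= /rA.
  have /nbhs_ballP[d /= d0 dA] := open_nbhs_nbhs (conj oA Axy).
  have [p [q [px xq pqd]]] := rat_box x d0.
  have [p' [q' [py yq pqd']]] := rat_box y d0.
  exists ((p, q), (p', q')) => //; case: pselect => [rA /=|].
    by split; rewrite /= in_itv /=; apply/andP.
  by case=> -[s t] [/= sI tI]; apply: dA; split; [exact: pqd|exact: pqd'].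
apply: countable_bigcupT_measurable => [|r]; first exact: countableP.
case: pselect => [rA|rA] /=; last exact: measurable0.
by apply: measurableX; exact: measurable_itv.
Qed.

Lemma continuous_plane_measurable f : continuous f ->
  measurable_fun setT (f : plane -> measurableTypeR R).
Proof.
move=> cf; apply: (measurability _ (measurable_realfun.RGenOpens.measurableE R)).
move=> _ [_ [a [b ->] <-]]; rewrite setTI; apply: open_plane_measurable.
by move/continuousP : cf; apply; exact: interval_open.
Qed.

Definition box (M : R) : set plane := [set` `[- M, M]] `*` [set` `[- M, M]].

(** The inequalities are weak, so f vanishes on the boundary of the box as well, and the boundary
    terms at [- M] and [M] are zero in integrations by parts. *)
Definition box_supported M f := forall x : R * R, M <= `|x.1| \/ M <= `|x.2| -> f x = 0.

Let mu2_setX (A B : set (measurableTypeR R)) : measurable A -> measurable B ->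
  (mu2 (A `*` B) = lebesgue_measure A * lebesgue_measure B)%E.
Proof. exact: product_measure1E. Qed.

Lemma measurable_box M : measurable (box M).
Proof. by apply: measurableX; exact: measurable_itv. Qed.

Lemma notin_box M f x : box_supported M f -> ~ box M x -> f x = 0.
Proof.
move=> fM xM; apply: fM.
case: (lerP M `|x.1|) => [|x1]; first by left.
case: (lerP M `|x.2|) => [|x2]; first by right.
by case: xM; split; rewrite /= in_itv /= -ler_norml ltW.
Qed.

Lemma bounded_box_supported M f : continuous f -> box_supported M f ->
  exists C : R, forall x, `|f x| <= C.
Proof.
move=> cf fM.
have cbox : compact ([set` `[- M, M]] `*` [set` `[- M, M]] : set (R * R)).
  by apply: compact_setX; exact: segment_compact.
have := @continuous_compact _ _ (f : R * R -> R^o) _ (continuous_subspaceT cf) cbox.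
move=> /compact_bounded[C [_ Cb]].
(* Compactness bounds f on the box by every number above C; the maximum with 0 covers the points
   outside, where f vanishes. *)
exists (Num.max 0 (C + 1)) => x; have [xM|xM] := pselect (box M x).
  rewrite le_max; apply/orP; right; apply: Cb; first by rewrite ltrDl.
  by exists x.
by rewrite (notin_box fM xM) normr0 le_max lexx.
Qed.

(** Domination by a constant multiple of the indicator of the box, whose measure is finite. *)
Lemma box_supported_integrable M f : continuous f -> box_supported M f ->
  mu2.-integrable setT (EFin \o f).
Proof.
move=> cf fM; have [C fC] := bounded_box_supported cf fM.
apply: (@le_integrable _ _ _ mu2 setT measurableT _ (fun x => (C * \1_(box M) x)%:E)).
- by apply/measurable_EFinP; exact: continuous_plane_measurable.
- move=> x _ /=; rewrite lee_fin indicE; have [xM|xM] := pselect (box M x).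
    by rewrite mem_set // mulr1 (le_trans (fC x)) // ler_norm.
  by rewrite (notin_box fM xM) normr0.
under eq_fun do rewrite EFinM.
apply: integrableZl => //.
apply/integrableP; split.
  by apply/measurable_EFinP; exact: measurable_indic (measurable_box M).
under eq_integral do rewrite gee0_abs ?lee_fin //.
rewrite integral_indic ?setIT //; last exact: measurable_box.
rewrite /reverse_coercion /box /= mu2_setX; [|exact: measurable_itv..].
by rewrite !lebesgue_measure_itv /=; case: ifP => _; rewrite ?mule0 // -EFinM ltry.
Qed.

Let integral_segment M (f : R -> R) : (forall t, M <= `|t| -> f t = 0) ->
  (\int[@lebesgue_measure R]_t (f t)%:E =
   \int[@lebesgue_measure R]_(t in `[(- M)%R, M]) (f t)%:E)%E.
Proof.
move=> fM; rewrite [RHS]integral_mkcond; apply: eq_integral => t _.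
rewrite patchE; case: ifPn => // tM; rewrite fM //.
by move: tM; rewrite notin_setE /= in_itv /= -ler_norml => /negP; rewrite -ltNge => /ltW.
Qed.

Let integral_derive_eq0 M (f : R -> R) : 0 < M ->
  (forall t, M <= `|t| -> f t = 0) ->
  (forall t, M <= `|t| -> 'D_1 f t = 0) ->
  (forall t, derivable f t 1) -> continuous ('D_1 f) ->
  (\int[@lebesgue_measure R]_t ('D_1 f t)%:E = 0)%E.
Proof.
move=> M0 fM dfM df cdf; rewrite (integral_segment dfM).
have cf : continuous f by move=> t; apply/differentiable_continuous/derivable1_diffP.
rewrite (@continuous_FTC2 R _ f) ?fM ?normrN ?gtr0_norm ?subee //.
- by rewrite gtrN.
- exact: continuous_subspaceT.
- split=> [t _|//|]; first exact: df.
  + by apply: cvg_at_right_filter; exact: cf.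
  + by apply: cvg_at_left_filter; exact: cf.
- by move=> t _; rewrite derive1E.
Qed.

(** The margin 1 ensures that f vanishes on a whole ball around each point considered, hence that
    its derivative there is that of the zero function. *)
Lemma pderiv_box_supported M f (i : 'I_2) : box_supported M f ->
  continuous (pderiv i f) -> box_supported (M + 1) (pderiv i f).
Proof.
move=> fM cdf x xM.
rewrite /pderiv (@near_eq_derive _ _ _ _ (fun=> 0)) ?derive_cst //.
have [d d0 dP] : exists2 d : R, 0 < d & forall y, ball x d y -> f y = 0.
  exists 1 => // -[y1 y2] [/= b1 b2]; apply: fM => /=.
  move: b1 b2; rewrite /ball /= => b1 b2.
  case: xM => [x1|x2]; [left|right].
    by move: (ler_distD y1 x.1 0); rewrite !subr0 => ?; lra.
  by move: (ler_distD y2 x.2 0); rewrite !subr0 => ?; lra.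
by apply/nbhs_ballP; exists d.
Qed.

(** By Fubini, integrate first in the direction i; every inner integral vanishes by the fundamental
    theorem of calculus. *)
Lemma Rintegral_pderiv M f (i : 'I_2) : 0 < M -> box_supported M f ->
  (forall x, derivable f x (basis_vec R i)) ->
  continuous (pderiv i f) ->
  \int[mu2]_x pderiv i f x = 0.
Proof.
move=> M0 fM df cdf.
have fM1 : box_supported (M + 1) f.
  by move=> x [|] xM; apply: fM; [left|right]; lra.
have dfM := pderiv_box_supported fM cdf.
have M10 : 0 < M + 1 by rewrite addr_gt0.
have idf := box_supported_integrable cdf dfM.
rewrite /Rintegral; case: (ord2P i) => ii; rewrite ii in df cdf dfM idf *.
- rewrite -integral21_prod_meas1 //= (eq_integral (cst 0%E)) ?integral0 // => y _.
  transitivity (\int[@lebesgue_measure R]_t ('D_1 (fun t => f (t, y)) t)%:E)%E.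
    by apply: eq_integral => t _; rewrite pderiv_fst.
  apply: (@integral_derive_eq0 (M + 1)) => //.
  + by move=> t tM; apply: fM1; left.
  + by move=> t tM; rewrite -pderiv_fst; apply: dfM; left.
  + by move=> t; apply/derivable_fst.
  + have -> : 'D_1 (fun t => f (t, y)) = fun t => pderiv 0 f (t, y).
      by apply/funext => t; rewrite pderiv_fst.
    move=> t; apply: (@continuous_comp _ _ _ (fun t : R => (t, y)) (pderiv 0 f)).
      exact: (cvg_pair cvg_id (cvg_cst y)).
    exact: cdf.
- rewrite -integral12_prod_meas1 //= (eq_integral (cst 0%E)) ?integral0 // => y _.
  transitivity (\int[@lebesgue_measure R]_t ('D_1 (fun t => f (y, t)) t)%:E)%E.
    by apply: eq_integral => t _; rewrite pderiv_snd.
  apply: (@integral_derive_eq0 (M + 1)) => //.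
  + by move=> t tM; apply: fM1; right.
  + by move=> t tM; rewrite -pderiv_snd; apply: dfM; right.
  + by move=> t; apply/derivable_snd.
  + have -> : 'D_1 (fun t => f (y, t)) = fun t => pderiv 1 f (y, t).
      by apply/funext => t; rewrite pderiv_snd.
    move=> t; apply: (@continuous_comp _ _ _ (fun t : R => (y, t)) (pderiv 1 f)).
      exact: (cvg_pair (cvg_cst y) cvg_id).
    exact: cdf.
Qed.

(** If c = f (a, b) were positive, f would be at least c / 2 on a square of positive measure. *)
Lemma Rintegral_eq0 M f : continuous f -> box_supported M f ->
  (forall x, 0 <= f x) -> \int[mu2]_x f x = 0 -> forall x, f x = 0.
Proof.
move=> cf fM f0 If [a b]; apply/eqP; rewrite eq_le f0 andbT leNgt.
apply/negP => fx0; set c := f (a, b) in fx0.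
have c20 : 0 < c / 2 by rewrite divr_gt0.
have [d d0 dP] : exists2 d : R, 0 < d & forall y, ball (a, b) d y -> c / 2 <= f y.
  have /cvgrPdist_lt /(_ _ c20) /nbhs_ballP[d /= d0 dP] := cf (a, b).
  exists d => // y /dP /=; rewrite -/c => cy.
  by move: (ler_norm (c - f y)) => ?; lra.
pose B : set plane := [set` `](a - d), (a + d)[] `*` [set` `](b - d), (b + d)[].
have mB : measurable B by apply: measurableX; exact: measurable_itv.
have mf := continuous_plane_measurable cf.
have intf := box_supported_integrable cf fM.
have : ((c / 2)%:E * mu2 B <= \int[mu2]_x (f x)%:E)%E.
  rewrite -integral_cst //.
  apply: (@le_trans _ _ (\int[mu2]_(x in B) (f x)%:E)%E).
    apply: ge0_le_integral => //.
    - by move=> x _; rewrite lee_fin ltW.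
    - by apply/measurable_EFinP; exact: measurable_funTS.
    - move=> [u v] [/= ua vb]; rewrite lee_fin; apply: dP; split;
        [move: ua|move: vb]; rewrite in_itv /= /ball /= ltr_distlC.
        by move=> /andP[? ?]; apply/andP; split; lra.
      by move=> /andP[? ?]; apply/andP; split; lra.
  apply: ge0_subset_integral => //; first by apply/measurable_EFinP.
  by move=> x _; rewrite lee_fin.
have -> : (\int[mu2]_x (f x)%:E = 0)%E.
  rewrite -[LHS]fineK; first by move: If; rewrite /Rintegral => ->.
  exact: integrable_fin_num.
have -> : mu2 B = ((a + d - (a - d)) * (b + d - (b - d)))%:E.
  rewrite /B mu2_setX; [|exact: measurable_itv..].
  by rewrite !lebesgue_measure_itv /= !lte_fin !ifT -?EFinD -?EFinM //; lra.
rewrite -EFinM lee_fin => H.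
suff : 0 < c / 2 * ((a + d - (a - d)) * (b + d - (b - d))) by rewrite ltNge H.
by rewrite !mulr_gt0 //; lra.
Qed.

End PlaneIntegral.

(* Otherwise a failing unification unfolds limits of difference quotients. *)
Local Opaque pderiv smooth.

(** * Cut-off functions *)

Section Bump.
Variable R : realType.
Implicit Types (g : R * R -> R) (x : R * R) (t : R) (i : 'I_2).

(** The factor [t^-n] makes the span of this family closed under derivation. *)
Definition flat n t : R := if 0 < t then t^-1 ^+ n * expR (- t^-1) else 0.

Lemma flat_ge0 n t : 0 <= flat n t.
Proof.
rewrite /flat; case: ifP => // t0.
by rewrite mulr_ge0 ?expR_ge0 // exprn_ge0 // invr_ge0 ltW.
Qed.

(** For t > 0 and s = 1 / t, the exponential series gives exp s >= s^(n+2) / (n+2)!. A quadratic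
    bound is what makes the derivative at 0 vanish. *)
Lemma flat_le n t : `|flat n t| <= n.+2`!%:R * t ^+ 2.
Proof.
rewrite ger0_norm ?flat_ge0 // /flat; case: ifP => [t0|_]; last first.
  by rewrite mulr_ge0 ?sqr_ge0.
have s0 : 0 < t^-1 by rewrite invr_gt0.
set s := t^-1 in s0 *.
have ts : t = s^-1 by rewrite /s invrK.
have fact0 : 0 < n.+2`!%:R :> R by rewrite ltr0n fact_gt0.
have le_exp : s ^+ n.+2 / n.+2`!%:R <= expR s.
  by apply: le_trans (expR_ge1Dxn n.+1 (ltW s0)); rewrite lerDr.
rewrite expRN ler_pdivrMr ?expR_gt0 // ts.
have -> : s ^+ n = n.+2`!%:R * s^-1 ^+ 2 * (s ^+ n.+2 / n.+2`!%:R).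
  by rewrite !exprS; field; rewrite !gt_eqF.
by apply: ler_wpM2l => //; rewrite mulr_ge0 ?sqr_ge0 // ltW.
Qed.

Lemma is_derive_flat n t :
  is_derive t 1 (flat n) (- n%:R * flat n.+1 t + flat n.+2 t).
Proof.
have [t0|t0|<-] := ltgtP 0 t.
- have tn0 : t != 0 by rewrite gt_eqF.
  apply: (@near_eq_is_derive _ _ _ (fun t => t^-1 ^+ n * expR (- t^-1))).
    near=> s; rewrite /flat ifT //; near: s; exact: lt_nbhsr.
  rewrite /flat t0.
  have dV : is_derive t 1 (fun t : R => t^-1) (- t ^- 2).
    apply: DeriveDef; first exact: (derivableV (f := id)).
    by rewrite (deriveV (f := id)) // derive_id [LHS]mulr1.
  have dX : is_derive t 1 (fun t : R => t^-1 ^+ n) (n%:R * t^-1 ^+ n.-1 * - t ^- 2).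
    rewrite (_ : (fun t : R => t^-1 ^+ n) = (fun t : R => t^-1) ^+ n); last first.
      by apply/funext => s; rewrite exprfctE.
    exact: is_deriveX.
  have dE : is_derive t 1 (fun t : R => expR (- t^-1)) (expR (- t^-1) * - (- t ^- 2)).
    exact: (is_derive1_comp (is_derive_expR _) (is_deriveN dV)).
  apply: (@is_derive_eq _ _ _ _ _ _ _ _ (is_deriveM dX dE)).
  rewrite /GRing.scale /= -!exprVn.
  case: n {dX} => [|n] /=; first by rewrite !expr0; ring.
  by rewrite !exprS; ring.
- apply: (@near_eq_is_derive _ _ _ (fun=> 0)).
    near=> s; rewrite /flat ifF //; apply/negbTE; rewrite -leNgt ltW //.
    by near: s; exact: lt_nbhsl.
  rewrite /flat (_ : (0 < t) = false) ?mulr0 ?addr0; first exact: is_derive_cst.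
  by apply/negbTE; rewrite -leNgt ltW.
- have -> : - n%:R * flat n.+1 0 + flat n.+2 0 = 0 :> R.
    by rewrite /flat ltxx mulr0 addr0.
  have cvg0 : h^-1 *: ((flat n \o shift 0) (h *: 1) - flat n 0) @[h --> 0^'] -->
      (0 : R).
    (* The difference quotient at 0 is at most (n+2)! |h| by [flat_le], so |h| <= e / (n+2)!
       suffices. *)
    apply/cvgr0Pnorm_le => e e0.
    have fact0 : 0 < n.+2`!%:R :> R by rewrite ltr0n fact_gt0.
    near=> h.
    have h0 : h != 0 by near: h; exact: nbhs_dnbhs_neq.
    rewrite /= addr0 /GRing.scale /= mulr1 {2}/flat ltxx subr0 normrM normfV.
    rewrite ler_pdivrMl ?normr_gt0 //.
    apply: (le_trans (flat_le n h)).
    have -> : h ^+ 2 = `|h| * `|h| by rewrite -expr2 real_normK ?num_real.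
    rewrite mulrCA ler_wpM2l // -ler_pdivlMl //; near: h.
    by apply: dnbhs0_le; rewrite mulr_gt0 // invr_gt0.
  by apply: DeriveDef; [apply/cvg_ex; exists 0|exact: cvg_lim].
Unshelve. all: by end_near. Qed.

(** On lines parallel to the axis i this is the chain rule in one variable. *)
Lemma pderiv_comp (h h' : R -> R) g i :
  (forall t, is_derive t 1 h (h' t)) ->
  (forall x, derivable g x (basis_vec R i)) ->
  (forall x, derivable (fun x => h (g x)) x (basis_vec R i)) /\
  pderiv i (fun x => h (g x)) = fun x => h' (g x) * pderiv i g x.
Proof.
move=> dh dg.
have chain (k : R -> R) t : derivable k t 1 ->
    is_derive t 1 (fun t => h (k t)) (h' (k t) * 'D_1 k t).
  by move=> dk; apply: (is_derive1_comp (dh (k t)) (derivableP dk)).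
have slice1 a b : i = 0 -> derivable (fun t => g (t, b)) a 1.
  by move=> i0; apply/derivable_fst; rewrite -i0.
have slice2 a b : i = 1 -> derivable (fun t => g (a, t)) b 1.
  by move=> i1; apply/derivable_snd; rewrite -i1.
case: (ord2P i) => ii; rewrite ii; split.
- by move=> [a b]; apply/derivable_fst; have [] := chain _ _ (slice1 a b ii).
- apply/funext => -[a b]; rewrite !pderiv_fst.
  by have [_ ->] := chain _ _ (slice1 a b ii).
- by move=> [a b]; apply/derivable_snd; have [] := chain _ _ (slice2 a b ii).
- apply/funext => -[a b]; rewrite !pderiv_snd.
  by have [_ ->] := chain _ _ (slice2 a b ii).
Qed.

Lemma continuous_flat n : continuous (flat n).
Proof.
move=> t; apply/differentiable_continuous/derivable1_diffP.
by have [] := is_derive_flat n t.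
Qed.

(** The induction on k keeps n general, because differentiating [flat n] produces [flat n.+1] and
    [flat n.+2]. *)
Lemma contdiff_flat k n g : contdiff k g -> contdiff k (fun x => flat n (g x)).
Proof.
elim: k n g => [|k IHk] n g cg.
  by move=> x; apply: continuous_comp; [exact: cg|exact: continuous_flat].
have [cg0 dg pg] := cg.
have comp_flat i := pderiv_comp (is_derive_flat n) (dg i).
split.
- by move=> x; apply: continuous_comp; [exact: cg0|exact: continuous_flat].
- by move=> i x; exact: (comp_flat i).1.
- move=> i; rewrite (comp_flat i).2; apply: contdiffM; last exact: pg.
  apply: contdiffD; last by apply: IHk; exact: contdiffW.
  by apply: contdiffM; [exact: contdiff_cst|apply: IHk; exact: contdiffW].
Qed.

Lemma smooth_flat n g : smooth g -> smooth (fun x => flat n (g x)).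
Proof. by move=> /smoothP sg; apply/smoothP => k; exact: contdiff_flat. Qed.

Lemma flat_eq0 n t : t <= 0 -> flat n t = 0.
Proof. by move=> t0; rewrite /flat ltNge t0. Qed.

Lemma flat0_ge t : 1 <= t -> flat 0 1 <= flat 0 t.
Proof.
move=> t1; have t0 : 0 < t by apply: lt_le_trans t1.
by rewrite /flat t0 ltr01 !expr0 !mul1r ler_expR lerN2 invr1 invf_le1.
Qed.

Lemma flat0_gt0 t : 0 < t -> 0 < flat 0 t.
Proof. by move=> t0; rewrite /flat t0 expr0 mul1r expR_gt0. Qed.

(** A well centred at a: flat zero at distance at most 1, and bounded below by [flat 0 1] from
    distance 2 on. *)
Definition plateau (a t : R) : R := flat 0 (t - a - 1) + flat 0 (a - 1 - t).

Lemma plateau_ge0 a t : 0 <= plateau a t.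
Proof. by rewrite addr_ge0 ?flat_ge0. Qed.

Lemma plateau_eq0 a t : `|t - a| <= 1 -> plateau a t = 0.
Proof.
rewrite ler_norml => /andP[? ?].
by rewrite /plateau !flat_eq0 ?addr0 //; lra.
Qed.

Lemma plateau_ge a t : 2 <= `|t - a| -> flat 0 1 <= plateau a t.
Proof.
rewrite ler_normr => /orP[|] ?.
  by apply: ler_wpDr; [exact: flat_ge0|apply: flat0_ge; lra].
by apply: ler_wpDl; [exact: flat_ge0|apply: flat0_ge; lra].
Qed.

(* Applying [flat 0] twice avoids dividing by a non-constant function. *)
Definition cutoff (p : R * R) x : R :=
  (flat 0 (flat 0 1))^-1 *
  flat 0 (flat 0 1 - (plateau p.1 x.1 + plateau p.2 x.2)).

Lemma smooth_cutoff p : smooth (cutoff p).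
Proof.
have sN f : smooth f -> smooth (fun x => - f x).
  move=> sf; under eq_fun do rewrite -mulN1r.
  exact: smoothM (smooth_cst _) sf.
have splateau f a : smooth f -> smooth (fun x => plateau a (f x)).
  move=> sf; apply: smoothD; apply: smooth_flat.
    exact: smoothD (smoothD sf (smooth_cst _)) (smooth_cst _).
  exact: smoothD (smooth_cst _) (sN _ sf).
apply: smoothM; first exact: smooth_cst.
apply: smooth_flat; apply: smoothD; first exact: smooth_cst.
apply: sN; apply: smoothD; apply: splateau;
  [exact: smooth_coord1|exact: smooth_coord2].
Qed.

Lemma cutoff_ge0 p x : 0 <= cutoff p x.
Proof. by rewrite mulr_ge0 ?invr_ge0 ?flat_ge0. Qed.

Lemma cutoff_eq1 p x : `|x.1 - p.1| <= 1 -> `|x.2 - p.2| <= 1 -> cutoff p x = 1.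
Proof.
move=> x1 x2; rewrite /cutoff !plateau_eq0 // addr0 subr0 mulVf //.
by rewrite gt_eqF // !flat0_gt0.
Qed.

Lemma cutoff_eq0 p x : 2 <= `|x.1 - p.1| \/ 2 <= `|x.2 - p.2| -> cutoff p x = 0.
Proof.
move=> xp; rewrite /cutoff [X in _ * X]flat_eq0 ?mulr0 // subr_le0.
case: xp => /plateau_ge xp.
  by apply: ler_wpDr => //; exact: plateau_ge0.
by apply: ler_wpDl => //; exact: plateau_ge0.
Qed.

End Bump.

(** * Uniqueness of the formal adjoint *)

Section FormalAdjoint.
Variable R : realType.
Local Notation vfun := (vfun R).
Local Notation mu2 := (@lebesgue_measure R \x @lebesgue_measure R)%E.

Definition vbox_supported n (M : R) (u : vfun n) :=
  forall x : R * R, M <= `|x.1| \/ M <= `|x.2| -> u x = 0.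

Lemma test_fun_box n (u : vfun n) : test_fun u ->
  exists2 M, 0 < M & vbox_supported M u.
Proof.
move=> [_ /compact_bounded[C [_ Cb]]].
(* The maximum with 0 makes M positive, and the added 1 puts M strictly above the bound C + 1 on the
   support. *)
exists (Num.max 0 (C + 1) + 1).
  by rewrite ltr_wpDl // le_max lexx.
move=> x xM; apply/eqP; apply: contraT => ux0.
have xC : `|x| <= C + 1.
  by apply: Cb; [rewrite ltrDl|exact: subset_closure].
have CM : C + 1 <= Num.max 0 (C + 1) by rewrite le_max lexx orbT.
move: xC; rewrite prod_normE ge_max => /andP[x1 x2].
by case: xM => ?; lra.
Qed.

(** The square is compact, hence closed, so it also contains the closure of the set where u is
    nonzero. *)
Lemma box_test_fun n M (u : vfun n) : vsmooth u -> vbox_supported M u -> test_fun u.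
Proof.
move=> su uM; split=> //.
have cK : compact ([set` `[- M, M]] `*` [set` `[- M, M]] : set (R * R)).
  by apply: compact_setX; exact: segment_compact.
have KE := compact_closed (@norm_hausdorff R (R * R)%type) cK.
apply: (subclosed_compact _ cK); first exact: closed_closure.
rewrite (proj1 (closure_id _) KE); apply: closure_subset => x /= ux0.
have notM : ~ (M <= `|x.1| \/ M <= `|x.2|) by move=> /uM u0; rewrite u0 eqxx in ux0.
split; rewrite /= in_itv /= -ler_norml leNgt; apply/negP => /ltW xM;
  apply: notM; first [by left|by right].
Qed.

Lemma vdot_box_supported n M (u v : vfun n) : vbox_supported M u ->
  box_supported M (vdot u v).
Proof.
by move=> uM x xM; rewrite /vdot big1 // => k _; rewrite uM // mxE mul0r.
Qed.

Lemma vdotC n (u v : vfun n) : vdot u v = vdot v u.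
Proof. by apply/funext => x; apply: eq_bigr => k _; rewrite mulrC. Qed.

Lemma smooth_vdot n (u v : vfun n) : vsmooth u -> vsmooth v -> smooth (vdot u v).
Proof.
move=> su sv; apply: smooth_sum => k.
by apply: smoothM; [exact: su|exact: sv].
Qed.

Lemma continuous_vdot n (u v : vfun n) : vsmooth u -> vsmooth v ->
  continuous (vdot u v).
Proof. by move=> su sv; exact: smooth_continuous (smooth_vdot su sv). Qed.

Lemma smooth_mderiv n a b (u : vfun n) k : vsmooth u ->
  smooth (fun x => mderiv a b u x k 0).
Proof.
move=> su; under eq_fun do rewrite mxE.
by apply: smooth_iter; apply: smooth_iter; exact: su.
Qed.

Lemma diff_op_vsmooth m n (B : vfun m -> vfun n) v :
  diff_op B -> vsmooth v -> vsmooth (B v).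
Proof.
move=> [N [C [sC BE]]] sv k.
have -> : vcomp (B v) k = fun x =>
    \sum_(a < N) \sum_(b < N) \sum_j C a b x k j * mderiv a b v x j 0.
  apply/funext => x; rewrite /vcomp BE // summxE; apply: eq_bigr => a _.
  by rewrite summxE; apply: eq_bigr => b _; rewrite mxE.
apply: smooth_sum => a; apply: smooth_sum => b; apply: smooth_sum => j.
by apply: smoothM; [exact: sC|exact: smooth_mderiv].
Qed.

Lemma diff_op_local m n (B : vfun m -> vfun n) u v x :
  diff_op B -> vsmooth u -> vsmooth v ->
  (\forall y \near x, u y = v y) -> B u x = B v x.
Proof.
move=> [N [C [_ BE]]] su sv uv; rewrite !BE //.
apply: eq_bigr => a _; apply: eq_bigr => b _; congr (_ *m _).
apply/matrixP => k j; rewrite !mxE.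
have uvk : \forall y \near x, vcomp u k y = vcomp v k y.
  by apply: filterS uv => y uvy; rewrite /vcomp uvy.
exact: (nbhs_singleton (near_iter_pderiv 0 a (near_iter_pderiv 1 b uvk))).
Qed.

Lemma vsmooth_scale n (f : R * R -> R) (v : vfun n) : smooth f -> vsmooth v ->
  vsmooth (fun x => f x *: v x).
Proof.
move=> sf sv k; have -> : vcomp (fun x => f x *: v x) k = fun x => f x * vcomp v k x.
  by apply/funext => x; rewrite /vcomp mxE.
by apply: smoothM; [exact: sf|exact: sv].
Qed.

Lemma cutoff_test_fun n (v : vfun n) (p : R * R) : vsmooth v ->
  test_fun (fun x => cutoff p x *: v x).
Proof.
(* A coordinate beyond this bound is at distance at least 2 from that of p, where the cut-off is
   zero. *)
move=> sv; apply: (@box_test_fun _ (`|p.1| + `|p.2| + 2)).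
  by apply: vsmooth_scale => //; exact: smooth_cutoff.
move=> x xM; rewrite cutoff_eq0 ?scale0r //.
have p1 := ler_distD 0 x.1 p.1; have p2 := ler_distD 0 x.2 p.2.
have := normr_ge0 p.1; have := normr_ge0 p.2 => p20 p10.
have := lerB_dist x.1 p.1; have := lerB_dist x.2 p.2 => d2 d1.
by case: xM => ?; [left|right]; lra.
Qed.

Lemma cutoff_near n (v : vfun n) (p : R * R) :
  \forall y \near p, v y = cutoff p y *: v y.
Proof.
apply/nbhs_ballP; exists 1 => //= -[y1 y2] [/= b1 b2].
rewrite cutoff_eq1 ?scale1r //= distrC ltW //.
Qed.

Lemma formal_adjoint_unique m n (A : vfun m -> vfun n) (B B' : vfun n -> vfun m) v :
  is_formal_adjoint A B -> is_formal_adjoint A B' -> vsmooth v -> B v = B' v.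
Proof.
move=> [dB adjB] [dB' adjB'].
have Etest w : test_fun w -> B w = B' w.
  move=> tw; have sw := tw.1; apply/funext => p.
  have sBw := diff_op_vsmooth dB sw; have sBw' := diff_op_vsmooth dB' sw.
  pose d : vfun m := fun x => B w x - B' w x.
  have sd : vsmooth d.
    move=> k; have -> : vcomp d k = fun x => vcomp (B w) k x + - 1 * vcomp (B' w) k x.
      by apply/funext => x; rewrite /vcomp !mxE mulN1r.
    by apply: smoothD; [exact: sBw|apply: smoothM; [exact: smooth_cst|exact: sBw']].
  (* Pairing with the cut-off difference turns the integrand into [cutoff p] times the squared norm
     of d, which is nonnegative and equals that squared norm at p. *)
  pose u : vfun m := fun x => cutoff p x *: d x.
  have tu : test_fun u by exact: cutoff_test_fun.
  have [M M0 uM] := test_fun_box tu.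
  have int0 : \int[mu2]_x vdot u d x = 0.
    have -> : vdot u d = fun x => vdot u (B w) x - vdot u (B' w) x.
      apply/funext => x; rewrite /vdot -sumrB; apply: eq_bigr => k _.
      by rewrite -mulrBr !mxE.
    rewrite RintegralB //.
    - apply/eqP; rewrite subr_eq0; apply/eqP.
      exact: etrans (esym (adjB u w tu tw)) (adjB' u w tu tw).
    - exact: box_supported_integrable (continuous_vdot tu.1 sBw)
        (vdot_box_supported _ uM).
    - exact: box_supported_integrable (continuous_vdot tu.1 sBw')
        (vdot_box_supported _ uM).
  have udE x : vdot u d x = cutoff p x * \sum_k (d x k 0) ^+ 2.
    rewrite /vdot mulr_sumr; apply: eq_bigr => k _.
    by rewrite mxE expr2 mulrA.
  have := @Rintegral_eq0 R M (vdot u d) _ _ _ int0 p.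
  rewrite udE cutoff_eq1 ?subrr ?normr0 // mul1r => E.
  have {}E : \sum_k (d p k 0) ^+ 2 = 0.
    apply: E.
    - exact: continuous_vdot tu.1 sd.
    - exact: vdot_box_supported uM.
    - move=> x; rewrite udE mulr_ge0 ?cutoff_ge0 //.
      by apply: sumr_ge0 => k _; exact: sqr_ge0.
  apply/eqP; rewrite -subr_eq0; apply/eqP/matrixP => k j; rewrite ord1 [RHS]mxE.
  apply/eqP; rewrite -sqrf_eq0; apply/eqP.
  by apply: (psumr_eq0P _ E) => // i _; exact: sqr_ge0.
(* For a general smooth v, cut off around p: this changes neither [B v p] nor [B' v p], and gives a
   test function. *)
move=> sv; apply/funext => p.
have tv := cutoff_test_fun p sv.
rewrite (diff_op_local dB sv tv.1 (cutoff_near v p)).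
by rewrite (diff_op_local dB' sv tv.1 (cutoff_near v p)) Etest.
Qed.

(** Exhibiting one adjoint B forces [get] to return some adjoint, and uniqueness identifies it with
    B on smooth functions. *)
Lemma formal_adjointE m n (A : vfun m -> vfun n) (B : vfun n -> vfun m) v :
  is_formal_adjoint A B -> vsmooth v -> formal_adjoint A v = B v.
Proof.
move=> AB; apply: (formal_adjoint_unique _ AB).
by apply: (@getPex _ [set B | is_formal_adjoint A B]); exists B.
Qed.

End FormalAdjoint.

(** * Operators with polynomial coefficients *)

Section FormalOperators.
Variable R : realType.
Implicit Types (f g : R * R -> R) (x : R * R).

(** [Term c (m, n) (a, b) k] stands for [c x1^m x2^n d1^a d2^b u_k]. *)
Record term := Term { tcoef : R; texp : nat * nat; tder : nat * nat; tcomp : nat }.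

(** Components are indexed by natural numbers, with zero out of range, so that term lists carry no
    ordinals and reduce by computation. *)
Definition vcoord m (u : R * R -> 'cV[R]_m) (k : nat) : R * R -> R :=
  if insub k is Some i then vcomp u i else fun=> 0.

Definition jet (u : nat -> R * R -> R) (d : nat * nat) k : R * R -> R :=
  iter d.1 (@pderiv R 0) (iter d.2 (@pderiv R 1) (u k)).

Definition ev_term (u : nat -> R * R -> R) (t : term) x : R :=
  tcoef t * (x.1 ^+ (texp t).1 * x.2 ^+ (texp t).2) * jet u (tder t) (tcomp t) x.

Definition ev u (L : seq term) x : R := \sum_(t <- L) ev_term u t x.

(** The Leibniz rule on one term, [true] standing for the second variable. A zero exponent
    contributes no second term. *)
Definition dterm (i : bool) (t : term) : seq term :=
  let: Term c (m, n) (a, b) k := t in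
  if i then
    Term c (m, n) (a, b.+1) k ::
      (if n is n'.+1 then [:: Term (c * n%:R) (m, n') (a, b) k] else [::])
  else
    Term c (m, n) (a.+1, b) k ::
      (if m is m'.+1 then [:: Term (c * m%:R) (m', n) (a, b) k] else [::]).

Definition dterms (i : bool) (L : seq term) : seq term := flatten (map (dterm i) L).

Definition mulmono (c : R) (e : nat * nat) (t : term) : term :=
  Term (c * tcoef t) (e.1 + (texp t).1, e.2 + (texp t).2)%N (tder t) (tcomp t).

(** [M k] is the term list of the component k of the inner operator, and t is a term of the outer
    one. *)
Definition comp_term (M : nat -> seq term) (t : term) : seq term :=
  map (mulmono (tcoef t) (texp t))
    (iter (tder t).1 (dterms false) (iter (tder t).2 (dterms true) (M (tcomp t)))).

Definition comp_terms (M : nat -> seq term) (L : seq term) : seq term :=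
  flatten (map (comp_term M) L).

Lemma ev_cat u L L' x : ev u (L ++ L') x = ev u L x + ev u L' x.
Proof. by rewrite /ev big_cat. Qed.

Lemma ev_cons u t L x : ev u (t :: L) x = ev_term u t x + ev u L x.
Proof. by rewrite /ev big_cons. Qed.

Lemma ev_nil u x : ev u [::] x = 0.
Proof. by rewrite /ev big_nil. Qed.

Section Eval.
Variable u : nat -> R * R -> R.
Hypothesis su : forall k, smooth (u k).

Lemma smooth_jet d k : smooth (jet u d k).
Proof. by apply: smooth_iter; exact: smooth_iter. Qed.

Lemma smooth_mono c (e : nat * nat) :
  smooth (fun x : R * R => c * (x.1 ^+ e.1 * x.2 ^+ e.2)).
Proof.
apply: smoothM; first exact: smooth_cst.
by apply: smoothM; apply: smoothX; [exact: smooth_coord1|exact: smooth_coord2].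
Qed.

Lemma smooth_ev_term t : smooth (ev_term u t).
Proof. by apply: smoothM; [exact: smooth_mono|exact: smooth_jet]. Qed.

Lemma smooth_ev L : smooth (ev u L).
Proof. by apply: smooth_sum => t; exact: smooth_ev_term. Qed.

Lemma pderiv_expr f (i : 'I_2) n : smooth f ->
  pderiv i (fun x => f x ^+ n) = fun x => n%:R * f x ^+ n.-1 * pderiv i f x.
Proof.
move=> sf; elim: n => [|n IHn].
  by rewrite pderiv_cst; apply/funext => x; rewrite !mul0r.
under eq_fun do rewrite exprS.
rewrite pderivM; last 2 first.
- by move=> x; exact: smooth_derivable.
- by move=> x; apply: smooth_derivable; exact: smoothX.
rewrite IHn; apply/funext => x /=; case: n {IHn} => [|n] /=; first by ring.
by rewrite [n.+2%:R]mulrS exprS; ring.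
Qed.

Lemma pderiv_mono (i : 'I_2) (e : nat * nat) :
  pderiv i (fun x : R * R => x.1 ^+ e.1 * x.2 ^+ e.2) =
  (fun x => (i == 0)%:R * e.1%:R * (x.1 ^+ e.1.-1 * x.2 ^+ e.2) +
            (i == 1)%:R * e.2%:R * (x.1 ^+ e.1 * x.2 ^+ e.2.-1)).
Proof.
rewrite pderivM; last 2 first.
- by move=> x; apply: smooth_derivable; apply: smoothX; exact: smooth_coord1.
- by move=> x; apply: smooth_derivable; apply: smoothX; exact: smooth_coord2.
rewrite pderiv_expr; last exact: smooth_coord2.
rewrite pderiv_expr; last exact: smooth_coord1.
rewrite pderiv_coord1 pderiv_coord2.
by apply/funext => x; ring.
Qed.

Lemma pderiv_ev_term (i : 'I_2) t :
  pderiv i (ev_term u t) = fun x =>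
   tcoef t * (x.1 ^+ (texp t).1 * x.2 ^+ (texp t).2) *
     pderiv i (jet u (tder t) (tcomp t)) x +
   jet u (tder t) (tcomp t) x * (tcoef t *
     ((i == 0)%:R * (texp t).1%:R * (x.1 ^+ (texp t).1.-1 * x.2 ^+ (texp t).2) +
      (i == 1)%:R * (texp t).2%:R * (x.1 ^+ (texp t).1 * x.2 ^+ (texp t).2.-1))).
Proof.
rewrite /ev_term pderivM; last 2 first.
- by move=> x; apply: smooth_derivable; exact: smooth_mono.
- by move=> x; apply: smooth_derivable; exact: smooth_jet.
rewrite pderivM; last 2 first.
- by move=> x; exact: derivable_cst.
- move=> x; apply: smooth_derivable.
  by apply: smoothM; apply: smoothX; [exact: smooth_coord1|exact: smooth_coord2].
by rewrite pderiv_cst pderiv_mono; apply/funext => x; ring.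
Qed.

Lemma pderiv0_jet d k : pderiv 0 (jet u d k) = jet u (d.1.+1, d.2) k.
Proof. by []. Qed.

Lemma pderiv1_jet d k : pderiv 1 (jet u d k) = jet u (d.1, d.2.+1) k.
Proof. by rewrite /jet pderiv1_iter0 //; exact: smooth_iter. Qed.

Lemma ev_dterm (i : bool) t :
  ev u (dterm i t) = pderiv (if i then 1 else 0) (ev_term u t).
Proof.
rewrite pderiv_ev_term; apply/funext => x.
case: t => c [m n] [a b] k /=; case: i => /=.
- rewrite pderiv1_jet ev_cons /=; case: n => [|n].
    by rewrite ev_nil /ev_term /=; ring.
  by rewrite ev_cons ev_nil /ev_term /=; ring.
- rewrite pderiv0_jet ev_cons /=; case: m => [|m].
    by rewrite ev_nil /ev_term /=; ring.
  by rewrite ev_cons ev_nil /ev_term /=; ring.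
Qed.

Lemma ev_dterms (i : bool) L :
  ev u (dterms i L) = pderiv (if i then 1 else 0) (ev u L).
Proof.
elim: L => [|t L IHL].
  have ev0 : ev u [::] = fun=> 0 by apply/funext => x; exact: ev_nil.
  by rewrite /dterms /= ev0 pderiv_cst.
have -> : ev u (t :: L) = fun x => ev_term u t x + ev u L x.
  by apply/funext => x; rewrite ev_cons.
rewrite pderivD; last 2 first.
- by move=> x; apply: smooth_derivable; exact: smooth_ev_term.
- by move=> x; apply: smooth_derivable; exact: smooth_ev.
by apply/funext => x; rewrite /dterms /= ev_cat ev_dterm -IHL.
Qed.

Lemma ev_iter_dterms (i : bool) n L :
  ev u (iter n (dterms i) L) = iter n (@pderiv R (if i then 1 else 0)) (ev u L).
Proof. by elim: n => [//|n IHn] /=; rewrite ev_dterms IHn. Qed.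

Lemma ev_mulmono c e L x :
  ev u (map (mulmono c e) L) x = c * (x.1 ^+ e.1 * x.2 ^+ e.2) * ev u L x.
Proof.
rewrite /ev big_map mulr_sumr; apply: eq_bigr => t _.
by rewrite /ev_term /mulmono /= !exprD; ring.
Qed.

(** Evaluation intertwines [dterms] with partial derivatives and [mulmono] with multiplication by a
    monomial. *)
Lemma ev_comp M L : ev (fun k => ev u (M k)) L = ev u (comp_terms M L).
Proof.
apply/funext => x; elim: L => [|t L IHL]; first by rewrite [LHS]ev_nil [RHS]ev_nil.
rewrite ev_cons IHL {1}/comp_terms /= ev_cat; congr (_ + _).
by rewrite /comp_term ev_mulmono !ev_iter_dterms /ev_term.
Qed.

End Eval.
End FormalOperators.

(** * Operators represented by rows of formal terms *)

Section Represents.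
Variable R : realType.
Local Notation vfun := (vfun R).

Lemma vcoordE m (u : vfun m) (k : 'I_m) : vcoord u k = vcomp u k.
Proof. by rewrite /vcoord valK. Qed.

Lemma comp_geq m (u : vfun m) k : (m <= k)%N -> vcoord u k = fun=> 0.
Proof. by move=> mk; rewrite /vcoord insubF // ltnNge mk. Qed.

Lemma smooth_vcoord m (u : vfun m) k : vsmooth u -> smooth (vcoord u k).
Proof.
by move=> su; rewrite /vcoord; case: insubP => [i _ _|_]; [|exact: smooth_cst].
Qed.

(** The size condition makes row k evaluate to [vcoord (A v) k] for every natural k: out of range
    both are zero. *)
Definition represents m n (A : vfun m -> vfun n) (L : seq (seq (term R))) :=
  size L = n /\
  forall v, vsmooth v -> forall (k : 'I_n) x,
    A v x k 0 = ev (vcoord v) (nth [::] L k) x.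

Section Basics.
Variables (m n : nat) (A : vfun m -> vfun n) (L : seq (seq (term R))).
Hypothesis rA : represents A L.

Lemma represents_vcomp v (k : 'I_n) : vsmooth v ->
  vcomp (A v) k = ev (vcoord v) (nth [::] L k).
Proof. by move=> sv; apply/funext => x; exact: rA.2. Qed.

Lemma represents_comp v k : vsmooth v ->
  vcoord (A v) k = ev (vcoord v) (nth [::] L k).
Proof.
move=> sv; case: (ltnP k n) => [kn|nk].
  by rewrite -(represents_vcomp (Ordinal kn) sv) -vcoordE.
rewrite comp_geq // nth_default ?rA.1 //.
by apply/funext => x; rewrite ev_nil.
Qed.

Lemma represents_vsmooth v : vsmooth v -> vsmooth (A v).
Proof.
move=> sv k; rewrite represents_vcomp //.
by apply: smooth_ev => j; exact: smooth_vcoord.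
Qed.

Lemma jet_geq v d k : (m <= k)%N -> jet (vcoord (v : vfun m)) d k = fun=> 0.
Proof.
have zero i j : iter j (@pderiv R i) (fun=> 0) = fun=> 0.
  by elim: j => [//|j IHj] /=; rewrite IHj pderiv_cst.
by move=> mk; rewrite /jet comp_geq // !zero.
Qed.

(** The contribution of t to the coefficient of d1^a d2^b u_j. *)
Definition term_coef (t : term R) (a b j : nat) x : R :=
  if (tder t == (a, b)) && (tcomp t == j)
  then tcoef t * (x.1 ^+ (texp t).1 * x.2 ^+ (texp t).2) else 0.

Lemma smooth_term_coef t a b j : smooth (term_coef t a b j).
Proof.
rewrite /term_coef; case: (_ && _); last exact: smooth_cst.
exact: smooth_mono.
Qed.

(** The coefficients act as Kronecker deltas and leave a single summand. If the component of t is
    out of range, none is left and the jet is zero. *)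
Lemma sum_term_coef v N t x : ((tder t).1 < N)%N -> ((tder t).2 < N)%N ->
  \sum_(a < N) \sum_(b < N) \sum_(j < m)
    term_coef t a b j x * jet (vcoord (v : vfun m)) (val a, val b) j x =
  ev_term (vcoord v) t x.
Proof.
rewrite /term_coef; case: t => c e [a b] k /= aN bN.
rewrite (bigD1 (Ordinal aN)) //= [X in _ + X]big1 => [|a' a'a]; last first.
  apply: big1 => b' _; apply: big1 => j _; rewrite xpair_eqE.
  case: (a =P a') => [aa'|_]; last by rewrite mul0r.
  by case/eqP: a'a; apply/val_inj.
rewrite addr0 (bigD1 (Ordinal bN)) //= [X in _ + X]big1 => [|b' b'b]; last first.
  apply: big1 => j _; rewrite xpair_eqE.
  case: (b =P b') => [bb'|_]; last by rewrite andbF mul0r.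
  by case/eqP: b'b; apply/val_inj.
rewrite addr0 eqxx /=; have [km|mk] := ltnP k m.
  rewrite (bigD1 (Ordinal km)) //= eqxx [X in _ + X]big1 ?addr0 // => j jk.
  case: (k =P j) => [kj|_]; last by rewrite mul0r.
  by case/eqP: jk; apply/val_inj.
rewrite /ev_term /= jet_geq // mulr0 big1 // => j _.
case: (k =P j) => [kj|_]; last by rewrite mul0r.
by move: mk; rewrite kj leqNgt ltn_ord.
Qed.

(** The hypothesis is a boolean bound on the derivative orders, so for a concrete term list it holds
    by computation. *)
Lemma represents_diff_op N :
  all (all (fun t => ((tder t).1 < N)%N && ((tder t).2 < N)%N)) L -> diff_op A.
Proof.
move=> /all_nthP bL; exists N.
exists (fun a b x => \matrix_(i, j) \sum_(t <- nth [::] L i) term_coef t a b j x).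
split.
  move=> a b i j; under eq_fun do rewrite mxE.
  by apply: smooth_sum => t; exact: smooth_term_coef.
move=> u su x; apply/matrixP => i j; rewrite ord1 rA.2 // /ev {j}.
transitivity (\sum_(t <- nth [::] L i) \sum_(a < N) \sum_(b < N) \sum_(j < m)
    term_coef t a b j x * jet (vcoord u) (val a, val b) j x).
  have iL : (i < size L)%N by rewrite rA.1.
  have := bL [::] i iL; elim: (nth [::] L i) => [|t l IHl]; first by rewrite !big_nil.
  move=> /= /andP[/andP[aN bN] lN]; rewrite !big_cons IHl //.
  by rewrite sum_term_coef.
rewrite exchange_big summxE; apply: eq_bigr => a _.
rewrite exchange_big summxE; apply: eq_bigr => b _.
rewrite exchange_big mxE; apply: eq_bigr => j _.
by rewrite !mxE mulr_suml; apply: eq_bigr => t _; rewrite /jet vcoordE.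
Qed.

End Basics.

(** The rows are compared on an arbitrary family u: with all derivatives in normal order, only
    coefficients of formal jets remain to be matched. *)
Lemma represents_eq m n (A B : vfun m -> vfun n) L L' v :
  represents A L -> represents B L' -> vsmooth v ->
  (forall u k x, (k < n)%N ->
    ev u (nth [::] L k) x = ev u (nth [::] L' k) x) ->
  A v = B v.
Proof.
move=> [_ rA] [_ rB] sv E; apply/funext => x; apply/matrixP => k j.
by rewrite ord1 rA // rB // E.
Qed.

(** This allows an operator known only on smooth functions, such as [formal_adjoint A], to inherit
    the term list of an explicit formula. *)
Lemma represents_ext m n (A B : vfun m -> vfun n) L :
  (forall v, vsmooth v -> A v = B v) -> represents B L -> represents A L.
Proof. by move=> AB [sL rB]; split=> // v sv k x; rewrite AB // rB. Qed.

Lemma represents_compose m n p (A : vfun m -> vfun n) (B : vfun n -> vfun p) L L' :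
  represents A L -> represents B L' ->
  represents (fun v => B (A v)) (map (comp_terms (nth [::] L)) L').
Proof.
move=> rA [sL' rB]; split=> [|v sv k x]; first by rewrite size_map.
rewrite rB; last exact: represents_vsmooth rA _ sv.
rewrite (nth_map [::]) ?sL' // -ev_comp; last by move=> j; exact: smooth_vcoord.
congr (ev _ _ x); apply/funext => j; exact: (represents_comp rA).
Qed.

Definition scale_terms (c : R) (L : seq (term R)) := map (mulmono c (0, 0)%N) L.

Definition lin_terms (c d : R) (L L' : seq (seq (term R))) :=
  [seq scale_terms c p.1 ++ scale_terms d p.2 | p <- zip L L'].

Lemma represents_lin m n (A B : vfun m -> vfun n) c d L L' :
  represents A L -> represents B L' ->
  represents (c *: A + d *: B) (lin_terms c d L L').
Proof.
move=> [sL rA] [sL' rB]; split=> [|v sv k x].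
  by rewrite size_map size1_zip ?sL ?sL'.
rewrite (nth_map ([::], [::])) ?size1_zip ?sL ?sL' // nth_zip ?sL ?sL' //=.
rewrite ev_cat !ev_mulmono /= -rA // -rB //.
by rewrite [LHS]mxE !mxE !expr0 !mulr1.
Qed.

Lemma represents_add m n (A B : vfun m -> vfun n) L L' :
  represents A L -> represents B L' ->
  represents (fun v => A v + B v) (lin_terms 1 1 L L').
Proof.
move=> rA rB; apply: represents_ext (represents_lin 1 1 rA rB) => v _.
by rewrite !scale1r.
Qed.

End Represents.

(** * Term lists of the operators of the theorem *)

Section Stone.
Variable R : realType.
Local Notation vfun := (vfun R).
Implicit Types (v : vfun 2) (w : vfun (2 + 1)).

Definition stone (al be ga : R) v : vfun (2 + 1) :=
  vpair (fun x => al *: v x - (2^-1 * divergence v x) *: Defs.pos x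
                  + (2^-1 * Defs.rot v x) *: pos_perp x)
        (fun x => be * divergence v x + ga * vdot (@Defs.pos R) v x).

Definition stone_adj (al be ga : R) w : vfun 2 :=
  fun x => al *: vel w x + (2^-1 * divergence (vel w) x) *: Defs.pos x
           - (2^-1 * Defs.rot (vel w) x) *: pos_perp x
           - be *: grad (pres w) x + (ga * pres w x) *: Defs.pos x.

Local Notation tm c m n a b k := (Term c (m, n)%N (a, b)%N k).

Definition lap_terms : seq (seq (term R)) :=
  [:: [:: tm 1 0 0 2 0 0; tm 1 0 0 0 2 0]; [:: tm 1 0 0 2 0 1; tm 1 0 0 0 2 1]].

Definition lame_terms nu : seq (seq (term R)) :=
  [:: [:: tm 1 0 0 2 0 0; tm 1 0 0 0 2 0; tm (-1) 0 0 1 0 2];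
      [:: tm 1 0 0 2 0 1; tm 1 0 0 0 2 1; tm (-1) 0 0 0 1 2];
      [:: tm 1 0 0 1 0 0; tm 1 0 0 0 1 1; tm (- nu) 0 0 0 0 2]].

Definition stone_terms al be ga : seq (seq (term R)) :=
  [:: [:: tm al 0 0 0 0 0; tm (- 2^-1) 1 0 1 0 0; tm (- 2^-1) 1 0 0 1 1;
          tm (- 2^-1) 0 1 1 0 1; tm 2^-1 0 1 0 1 0];
      [:: tm al 0 0 0 0 1; tm (- 2^-1) 0 1 1 0 0; tm (- 2^-1) 0 1 0 1 1;
          tm 2^-1 1 0 1 0 1; tm (- 2^-1) 1 0 0 1 0];
      [:: tm be 0 0 1 0 0; tm be 0 0 0 1 1; tm ga 1 0 0 0 0; tm ga 0 1 0 0 1]].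

Definition stone_adj_terms al be ga : seq (seq (term R)) :=
  [:: [:: tm al 0 0 0 0 0; tm 2^-1 1 0 1 0 0; tm 2^-1 1 0 0 1 1;
          tm 2^-1 0 1 1 0 1; tm (- 2^-1) 0 1 0 1 0;
          tm (- be) 0 0 1 0 2; tm ga 1 0 0 0 2];
      [:: tm al 0 0 0 0 1; tm 2^-1 0 1 1 0 0; tm 2^-1 0 1 0 1 1;
          tm (- 2^-1) 1 0 1 0 1; tm 2^-1 1 0 0 1 0;
          tm (- be) 0 0 0 1 2; tm ga 0 1 0 0 2]].

Definition Qhat_terms nu : seq (seq (term R)) :=
  [:: [:: tm 1 1 0 1 0 0; tm 1 1 0 0 1 1; tm (- nu) 1 0 0 0 2];
      [:: tm 1 0 1 1 0 0; tm 1 0 1 0 1 1; tm (- nu) 0 1 0 0 2]].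

Definition Shat_terms : seq (seq (term R)) :=
  [:: [:: tm 1 1 0 2 0 2; tm 1 1 0 0 2 2; tm 2 0 0 1 0 2];
      [:: tm 1 0 1 2 0 2; tm 1 0 1 0 2 2; tm 2 0 0 0 1 2]].

Definition That_terms nu : seq (seq (term R)) :=
  [:: [:: tm 2^-1 2 0 1 0 2; tm 2^-1 0 2 1 0 2; tm (2 * nu) 1 0 0 0 2];
      [:: tm 2^-1 2 0 0 1 2; tm 2^-1 0 2 0 1 2; tm (2 * nu) 0 1 0 0 2];
      [:: tm 4 0 0 0 0 2; tm 2 1 0 1 0 2; tm 2 0 1 0 1 2]].

Definition T_terms nu (c := 4 * lambda_nu nu) : seq (seq (term R)) :=
  [:: [:: tm (c * 2^-1) 1 0 0 0 2; tm (c * 8^-1) 2 0 0 0 0;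
          tm (c * 8^-1) 0 2 0 0 0];
      [:: tm (c * 2^-1) 0 1 0 0 2; tm (c * 8^-1) 2 0 0 0 1;
          tm (c * 8^-1) 0 2 0 0 1];
      [:: tm (c * (3 - 2 * nu)) 0 0 0 0 2; tm (c * 2^-1) 1 0 0 0 0;
          tm (c * 2^-1) 0 1 0 0 1]].

Definition Ttilde_terms nu (c := 2^-1 * lambda_nu nu) : seq (seq (term R)) :=
  [:: [:: tm c 2 0 0 0 0; tm c 0 2 0 0 0]; [:: tm c 2 0 0 0 1; tm c 0 2 0 0 1]].

Definition Tcheck_terms : seq (seq (term R)) :=
  [:: [:: tm 2^-1 2 0 0 0 0; tm 2^-1 1 1 0 0 1];
      [:: tm 2^-1 1 1 0 0 0; tm 2^-1 0 2 0 0 1]].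

Definition id_terms n : seq (seq (term R)) := [seq [:: tm 1 0 0 0 0 k] | k <- iota 0 n].

Lemma vpair_lshift (u : vfun 2) p x (k : 'I_2) :
  vpair u p x (lshift 1 k) 0 = u x k 0.
Proof. by rewrite /vpair col_mxEu. Qed.

Lemma vpair_rshift (u : vfun 2) p x (k : 'I_1) :
  vpair u p x (rshift 2 k) 0 = p x.
Proof. by rewrite /vpair col_mxEd ord1 mxE eqxx mulr1n. Qed.

Lemma velE w (k : 'I_2) : vcomp (vel w) k = vcoord w k.
Proof.
rewrite -[nat_of_ord k]/(nat_of_ord (lshift 1 k)) vcoordE.
by apply/funext => x; rewrite /vcomp /vel mxE.
Qed.

Lemma presE w : pres w = vcoord w 2.
Proof.
rewrite -[2%N]/(nat_of_ord (rshift 2 (0 : 'I_1))) vcoordE.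
by apply/funext => x; rewrite /vcomp /pres mxE.
Qed.

Lemma entryE v x (k : 'I_2) : v x k 0 = vcoord v k x.
Proof. by rewrite vcoordE. Qed.

Lemma vel_entryE w x (k : 'I_2) : vel w x k 0 = vcoord w k x.
Proof. by rewrite -velE. Qed.

Lemma lshift_entryE w x (k : 'I_2) : w x (lshift 1 k) 0 = vcoord w k x.
Proof. by rewrite -velE /vcomp /vel mxE. Qed.

Lemma vdotE2 (u v : vfun 2) x :
  vdot u v x = u x 0 0 * v x 0 0 + u x 1 0 * v x 1 0.
Proof.
rewrite /vdot !big_ord_recl big_ord0 addr0.
by have -> : lift ord0 ord0 = 1 :> 'I_2 by apply/val_inj.
Qed.

Lemma vdot_pos v x : vdot (@Defs.pos R) v x = x.1 * v x 0 0 + x.2 * v x 1 0.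
Proof. by rewrite vdotE2; congr (_ * _ + _ * _); rewrite mxE. Qed.

Lemma vdot_pos_pos (x : R * R) :
  vdot (@Defs.pos R) (@Defs.pos R) x = x.1 ^+ 2 + x.2 ^+ 2.
Proof. by rewrite vdot_pos !expr2; congr (_ * _ + _ * _); rewrite mxE. Qed.

Lemma vdot_pos_grad (p : R * R -> R) (x : R * R) :
  vdot (@Defs.pos R) (grad p) x = x.1 * pderiv 0 p x + x.2 * pderiv 1 p x.
Proof. by rewrite vdot_pos; congr (_ * _ + _ * _); rewrite mxE. Qed.

Lemma represents_id n : represents (@id (vfun n)) (id_terms n).
Proof.
split=> [|v sv k x]; first by rewrite size_map size_iota.
rewrite (nth_map 0%N) ?size_iota // nth_iota // add0n.
by rewrite ev_cons ev_nil /ev_term /= /jet /= vcoordE !expr0 !mul1r addr0.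
Qed.

(** The derivations and the components of v are generalized, so that [ring] meets derivatives only
    as atoms. *)
Ltac eval_terms v :=
  rewrite /= !ev_cons ev_nil /ev_term /jet /=;
  try move: (pderiv 0); try move: (pderiv 1); move: (vcoord v) => ? *; ring.

Lemma represents_lap : represents (@vlaplacian R 2) lap_terms.
Proof.
split=> // v sv k x; rewrite /vlaplacian mxE /laplacian -!vcoordE.
by case: (ord2P k) => ->; eval_terms v.
Qed.

Lemma represents_lame nu : represents (lame_navier nu) (lame_terms nu).
Proof.
split=> // w sw k x; rewrite /lame_navier; case: (split_ordP k) => j ->.
  rewrite vpair_lshift ![in LHS]mxE /laplacian velE presE.
  by case: (ord2P j) => ->; eval_terms w.
rewrite vpair_rshift ord1 /divergence !velE presE.
by eval_terms w.
Qed.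

Lemma represents_stone al be ga : represents (stone al be ga) (stone_terms al be ga).
Proof.
split=> // v sv k x; rewrite /stone /divergence /Defs.rot.
case: (split_ordP k) => j ->.
  rewrite vpair_lshift ![in LHS]mxE (entryE v) -!vcoordE.
  by case: (ord2P j) => ->; eval_terms v.
rewrite vpair_rshift ord1 vdot_pos !(entryE v) -!vcoordE.
by eval_terms v.
Qed.

Lemma represents_stone_adj al be ga :
  represents (stone_adj al be ga) (stone_adj_terms al be ga).
Proof.
split=> // w sw k x; rewrite /stone_adj /divergence /Defs.rot /grad.
rewrite ![in LHS]mxE !velE lshift_entryE presE.
by case: (ord2P k) => ->; eval_terms w.
Qed.

Lemma represents_Qhat nu : represents (opQhat nu) (Qhat_terms nu).
Proof.
split=> // w sw k x; rewrite /opQhat /divergence ![in LHS]mxE !velE presE.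
by case: (ord2P k) => ->; eval_terms w.
Qed.

Lemma represents_Shat : represents (@opShat R) Shat_terms.
Proof.
split=> // w sw k x; rewrite /opShat /laplacian /grad ![in LHS]mxE presE.
by case: (ord2P k) => ->; eval_terms w.
Qed.

Lemma represents_That nu : represents (opThat nu) (That_terms nu).
Proof.
split=> // w sw k x; rewrite /opThat.
case: (split_ordP k) => j ->.
  rewrite vpair_lshift vdot_pos_pos ![in LHS]mxE presE.
  by case: (ord2P j) => ->; eval_terms w.
rewrite vpair_rshift ord1 vdot_pos_grad presE.
by eval_terms w.
Qed.

Lemma represents_T nu : represents (opT nu) (T_terms nu).
Proof.
split=> // w sw k x; rewrite /opT [LHS]mxE.
case: (split_ordP k) => j ->.
  rewrite vpair_lshift vdot_pos_pos ![in X in _ * X = _]mxE presE.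
  rewrite ?vel_entryE ?lshift_entryE.
  by case: (ord2P j) => ->; eval_terms w.
rewrite vpair_rshift ord1 vdot_pos !vel_entryE presE.
by eval_terms w.
Qed.

Lemma represents_Ttilde nu : represents (opTtilde nu) (Ttilde_terms nu).
Proof.
split=> // v sv k x; rewrite /opTtilde vdot_pos_pos [LHS]mxE (entryE v).
by case: (ord2P k) => ->; eval_terms v.
Qed.

Lemma represents_Tcheck : represents (@opTcheck R) Tcheck_terms.
Proof.
split=> // v sv k x; rewrite /opTcheck vdot_pos ![in LHS]mxE !(entryE v).
by case: (ord2P k) => ->; eval_terms v.
Qed.

End Stone.

(** * The six identities at the level of term lists *)

Section Golden.
Variables (R : realType) (nu lambda : R).
Local Notation vfun := (vfun R).
Hypotheses (nu_neq_half : nu <> 2^-1) (nu_neq_one : nu <> 1).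

Lemma opPE : opP nu = stone (1 - 2 * nu) (- 2) 0.
Proof.
apply/funext => v; congr vpair; apply/funext => x.
by rewrite mul0r addr0.
Qed.

Lemma opRE : opR nu = stone (2 - 2 * nu) 0 (- 2^-1).
Proof.
apply/funext => v; congr vpair; apply/funext => x.
by rewrite mul0r add0r.
Qed.

Let P_terms := stone_terms (1 - 2 * nu) (- 2) 0.
Let R_terms := stone_terms (2 - 2 * nu) 0 (- 2^-1).
Let Q_terms := lin_terms (2 * lambda_nu nu) lambda
  (stone_adj_terms (2 - 2 * nu) 0 (- 2^-1)) (Qhat_terms nu).
Let S_terms := lin_terms (2 * lambda_nu nu) lambda
  (stone_adj_terms (1 - 2 * nu) (- 2) 0) (Shat_terms R).
Let Tsum_terms := lin_terms 1 lambda (T_terms nu) (That_terms nu).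
Let Ttsum_terms := lin_terms 1 lambda (Ttilde_terms nu) (Tcheck_terms R).

(** With [nu_one_unit], this gives the nonzero denominators that [field] requires once [lambda_nu]
    is unfolded. *)
Lemma nu_half_unit : 1 - 2 * nu != 0.
Proof.
apply/eqP => E; apply: nu_neq_half; apply: (@mulfI _ 2); first by rewrite pnatr_eq0.
by rewrite divff ?pnatr_eq0 //; apply/esym/subr0_eq.
Qed.

Lemma nu_one_unit : 1 - nu != 0.
Proof. by apply/eqP => E; apply: nu_neq_one; apply/esym/subr0_eq. Qed.

Let Q := (2 * lambda_nu nu) *: stone_adj (2 - 2 * nu) 0 (- 2^-1) + lambda *: opQhat nu.
Let S := (2 * lambda_nu nu) *: stone_adj (1 - 2 * nu) (- 2) 0 + lambda *: @opShat R.
(** The factor 1 fits the shape of [represents_lin]. *)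
Let T' := 1 *: opT nu + lambda *: opThat nu.
Let Tt := 1 *: opTtilde nu + lambda *: @opTcheck R.

Lemma represents_P : represents (opP nu) P_terms.
Proof. by rewrite opPE; exact: represents_stone. Qed.

Lemma represents_R : represents (opR nu) R_terms.
Proof. by rewrite opRE; exact: represents_stone. Qed.

Lemma represents_Q : represents Q Q_terms.
Proof.
by apply: represents_lin; [exact: represents_stone_adj|exact: represents_Qhat].
Qed.

Lemma represents_S : represents S S_terms.
Proof.
by apply: represents_lin; [exact: represents_stone_adj|exact: represents_Shat].
Qed.

Lemma represents_Tsum : represents T' Tsum_terms.
Proof. by apply: represents_lin; [exact: represents_T|exact: represents_That]. Qed.

Lemma represents_Ttsum : represents Tt Ttsum_terms.
Proof. by apply: represents_lin; [exact: represents_Ttilde|exact: represents_Tcheck]. Qed.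

Let halfN := nu_half_unit.
Let oneN := nu_one_unit.

(* With [jet] abstracted, [field] tells its atoms apart by their numeric indices. *)
Ltac compare_terms :=
  cbv beta iota zeta delta
    [nth map foldr flatten cat iter zip iota fst snd addn Nat.add
     tcoef texp tder tcomp dterm dterms mulmono comp_term comp_terms
     scale_terms lin_terms id_terms P_terms Q_terms R_terms S_terms Tsum_terms Ttsum_terms
     lap_terms lame_terms stone_terms stone_adj_terms Qhat_terms Shat_terms
     That_terms T_terms Ttilde_terms Tcheck_terms];
  rewrite /ev !big_cons !big_nil /ev_term /=;
  move: (jet _) => J; rewrite /lambda_nu; field; rewrite ?halfN ?oneN //.

(** In this and the next five identities, the argument of [comp_terms] is the inner operator and the
    mapped list is the outer one. *)
Lemma golden_AP_terms u k x : (k < 3)%N ->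
  ev u (nth [::] (map (comp_terms (nth [::] P_terms)) (lame_terms nu)) k) x =
  ev u (nth [::] (map (comp_terms (nth [::] (lap_terms R))) R_terms) k) x.
Proof. by case: k => [|[|[|//]]] _; compare_terms. Qed.

Lemma golden_BQ_terms u k x : (k < 2)%N ->
  ev u (nth [::] (map (comp_terms (nth [::] Q_terms)) (lap_terms R)) k) x =
  ev u (nth [::] (map (comp_terms (nth [::] (lame_terms nu))) S_terms) k) x.
Proof. by case: k => [|[|//]] _; compare_terms. Qed.

Lemma golden_PQ_terms u k x : (k < 3)%N ->
  ev u (nth [::] (lin_terms 1 1
    (map (comp_terms (nth [::] Q_terms)) P_terms)
    (map (comp_terms (nth [::] (lame_terms nu))) Tsum_terms)) k) x =
  ev u (nth [::] (id_terms R 3) k) x.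
Proof. by case: k => [|[|[|//]]] _; compare_terms. Qed.

Lemma golden_RS_terms u k x : (k < 3)%N ->
  ev u (nth [::] (lin_terms 1 1
    (map (comp_terms (nth [::] S_terms)) R_terms)
    (map (comp_terms (nth [::] Tsum_terms)) (lame_terms nu))) k) x =
  ev u (nth [::] (id_terms R 3) k) x.
Proof. by case: k => [|[|[|//]]] _; compare_terms. Qed.

Lemma golden_QP_terms u k x : (k < 2)%N ->
  ev u (nth [::] (lin_terms 1 1
    (map (comp_terms (nth [::] P_terms)) Q_terms)
    (map (comp_terms (nth [::] (lap_terms R))) Ttsum_terms)) k) x =
  ev u (nth [::] (id_terms R 2) k) x.
Proof. by case: k => [|[|//]] _; compare_terms. Qed.

Lemma golden_SR_terms u k x : (k < 2)%N ->
  ev u (nth [::] (lin_terms 1 1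
    (map (comp_terms (nth [::] R_terms)) S_terms)
    (map (comp_terms (nth [::] Ttsum_terms)) (lap_terms R))) k) x =
  ev u (nth [::] (id_terms R 2) k) x.
Proof. by case: k => [|[|//]] _; compare_terms. Qed.

End Golden.

(** * The formal adjoints of P and R *)

Section StoneAdjoint.
Variable R : realType.
Local Notation vfun := (vfun R).
Implicit Types (f g h : R * R -> R) (v : vfun 2) (w : vfun (2 + 1)).

Lemma smooth_pderivD (i : 'I_2) f g : smooth f -> smooth g ->
  pderiv i (fun x => f x + g x) = (fun x => pderiv i f x + pderiv i g x).
Proof. by move=> sf sg; apply: pderivD => x; exact: smooth_derivable. Qed.

Lemma smooth_pderivM (i : 'I_2) f g : smooth f -> smooth g ->
  pderiv i (fun x => f x * g x) = (fun x => f x * pderiv i g x + g x * pderiv i f x).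
Proof. by move=> sf sg; apply: pderivM => x; exact: smooth_derivable. Qed.

Lemma vdot_vpair (u : vfun 2) p w x :
  vdot (vpair u p) w x = vdot u (vel w) x + p x * pres w x.
Proof.
rewrite /vdot big_split_ord big_ord1 vpair_rshift /pres mxE; congr (_ + _).
by apply: eq_bigr => k _; rewrite vpair_lshift mxE.
Qed.

Lemma smooth_pderivZ (i : 'I_2) (c : R) f : smooth f ->
  pderiv i (fun x => c * f x) = fun x => c * pderiv i f x.
Proof.
move=> sf; rewrite (smooth_pderivM _ (smooth_cst c) sf) pderiv_cst.
by apply/funext => x; rewrite mulr0 addr0.
Qed.

Lemma smoothZ (c : R) f : smooth f -> smooth (fun x => c * f x).
Proof. exact: smoothM (smooth_cst c). Qed.

Section Flux.
Variables (be : R) (a0 a1 b0 b1 b2 : R * R -> R).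
Hypotheses (sa0 : smooth a0) (sa1 : smooth a1).
Hypotheses (sb0 : smooth b0) (sb1 : smooth b1) (sb2 : smooth b2).

Definition radial x : R := x.1 * b0 x + x.2 * b1 x.
Definition angular x : R := x.1 * b1 x + - 1 * (x.2 * b0 x).

(** With a = (a0, a1), b = (b0, b1), the flux is F = - (x.b) a / 2 + (x^perp.b) (a1, - a0) / 2 + be
    b2 a, where [radial] is x.b and [angular] is x^perp.b. It comes from integrating by parts the
    terms in div a and in rot a, which is the divergence of (a1, - a0). *)
Definition flux1 x : R :=
  - 2^-1 * (a0 x * radial x) + 2^-1 * (a1 x * angular x) + be * (a0 x * b2 x).

Definition flux2 x : R :=
  - 2^-1 * (a1 x * radial x) + - 2^-1 * (a0 x * angular x) + be * (a1 x * b2 x).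

Let s1 := @smooth_coord1 R.
Let s2 := @smooth_coord2 R.

Let smooth_radial : smooth radial.
Proof. exact: smoothD (smoothM s1 sb0) (smoothM s2 sb1). Qed.

Let smooth_angular : smooth angular.
Proof. exact: smoothD (smoothM s1 sb1) (smoothZ (- 1) (smoothM s2 sb0)). Qed.

Lemma pderiv_radial (i : 'I_2) : pderiv i radial = fun x =>
  x.1 * pderiv i b0 x + b0 x * (i == 0)%:R +
  (x.2 * pderiv i b1 x + b1 x * (i == 1)%:R).
Proof.
rewrite (smooth_pderivD _ (smoothM s1 sb0) (smoothM s2 sb1)).
by rewrite (smooth_pderivM _ s1 sb0) (smooth_pderivM _ s2 sb1) pderiv_coord1 pderiv_coord2.
Qed.

Lemma pderiv_angular (i : 'I_2) : pderiv i angular = fun x =>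
  x.1 * pderiv i b1 x + b1 x * (i == 0)%:R +
  - 1 * (x.2 * pderiv i b0 x + b0 x * (i == 1)%:R).
Proof.
rewrite (smooth_pderivD _ (smoothM s1 sb1) (smoothZ (- 1) (smoothM s2 sb0))).
rewrite (smooth_pderivZ _ _ (smoothM s2 sb0)).
by rewrite (smooth_pderivM _ s1 sb1) (smooth_pderivM _ s2 sb0) pderiv_coord1 pderiv_coord2.
Qed.

(** Both components of the flux have this shape, so one statement serves for their smoothness and
    their derivatives. *)
Let smooth_pderiv_sum3 (i : 'I_2) (a b c : R) f g h f' g' h' :
  smooth f -> smooth g -> smooth h -> smooth f' -> smooth g' -> smooth h' ->
  let F := fun x => a * (f x * f' x) + b * (g x * g' x) + c * (h x * h' x) in
  smooth F /\
  pderiv i F = fun x =>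
    a * (f x * pderiv i f' x + f' x * pderiv i f x) +
    b * (g x * pderiv i g' x + g' x * pderiv i g x) +
    c * (h x * pderiv i h' x + h' x * pderiv i h x).
Proof.
move=> sf sg sh sf' sg' sh' F.
have sab := smoothD (smoothZ a (smoothM sf sf')) (smoothZ b (smoothM sg sg')).
have sc := smoothZ c (smoothM sh sh').
split; first exact: smoothD sab sc.
rewrite /F (smooth_pderivD _ sab sc).
rewrite (smooth_pderivD _ (smoothZ a (smoothM sf sf')) (smoothZ b (smoothM sg sg'))).
rewrite (smooth_pderivZ _ a (smoothM sf sf')) (smooth_pderivZ _ b (smoothM sg sg')).
rewrite (smooth_pderivZ _ c (smoothM sh sh')).
by rewrite (smooth_pderivM _ sf sf') (smooth_pderivM _ sg sg') (smooth_pderivM _ sh sh').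
Qed.

Let flux1P i := smooth_pderiv_sum3 i (- 2^-1) 2^-1 be
  sa0 sa1 sa0 smooth_radial smooth_angular sb2.
Let flux2P i := smooth_pderiv_sum3 i (- 2^-1) (- 2^-1) be
  sa1 sa0 sa1 smooth_radial smooth_angular sb2.

Lemma smooth_flux1 : smooth flux1. Proof. exact: (flux1P 0).1. Qed.
Lemma smooth_flux2 : smooth flux2. Proof. exact: (flux2P 0).1. Qed.

(** The al and ga terms cancel between the two pairings. So do the undifferentiated b0 and b1 that
    arise from differentiating x in [radial] and [angular], which is why the adjoint keeps the
    coefficient al unchanged. *)
Lemma flux_divergence al ga x :
  pderiv 0 flux1 x + pderiv 1 flux2 x =
  (al * a0 x - 2^-1 * (pderiv 0 a0 x + pderiv 1 a1 x) * x.1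
    - 2^-1 * (pderiv 0 a1 x - pderiv 1 a0 x) * x.2) * b0 x +
  (al * a1 x - 2^-1 * (pderiv 0 a0 x + pderiv 1 a1 x) * x.2
    + 2^-1 * (pderiv 0 a1 x - pderiv 1 a0 x) * x.1) * b1 x +
  (be * (pderiv 0 a0 x + pderiv 1 a1 x) + ga * (x.1 * a0 x + x.2 * a1 x)) * b2 x
  - (a0 x * (al * b0 x + 2^-1 * (pderiv 0 b0 x + pderiv 1 b1 x) * x.1
       + 2^-1 * (pderiv 0 b1 x - pderiv 1 b0 x) * x.2
       - be * pderiv 0 b2 x + ga * b2 x * x.1) +
     a1 x * (al * b1 x + 2^-1 * (pderiv 0 b0 x + pderiv 1 b1 x) * x.2
       - 2^-1 * (pderiv 0 b1 x - pderiv 1 b0 x) * x.1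
       - be * pderiv 1 b2 x + ga * b2 x * x.2)).
Proof.
rewrite /flux1 /flux2 (flux1P 0).2 (flux2P 1).2 !pderiv_radial !pderiv_angular.
rewrite /radial /angular /=.
move: (pderiv 0) (pderiv 1) => D0 D1; by field.
Qed.
End Flux.

Definition stone_flux1 be v w :=
  flux1 be (vcoord v 0) (vcoord v 1) (vcoord w 0) (vcoord w 1) (vcoord w 2).
Definition stone_flux2 be v w :=
  flux2 be (vcoord v 0) (vcoord v 1) (vcoord w 0) (vcoord w 1) (vcoord w 2).

Lemma stone_divergence al be ga v w x : vsmooth v -> vsmooth w ->
  vdot (stone al be ga v) w x - vdot v (stone_adj al be ga w) x =
  pderiv 0 (stone_flux1 be v w) x + pderiv 1 (stone_flux2 be v w) x.
Proof.
move=> sv sw; have sc k := smooth_vcoord k sv; have sd k := smooth_vcoord k sw.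
rewrite (flux_divergence be (sc 0%N) (sc 1%N) (sd 0%N) (sd 1%N) (sd 2%N) al ga).
rewrite /stone /stone_adj vdot_vpair vdot_pos /divergence /Defs.rot !vdotE2 presE.
rewrite ![in LHS]mxE !(entryE v) !lshift_entryE !velE -!vcoordE /=.
move: (pderiv 0) (pderiv 1) (vcoord v) (vcoord w) => D0 D1 a b.
by ring.
Qed.

End StoneAdjoint.

Section StoneFormalAdjoint.
Variable R : realType.
Local Notation vfun := (vfun R).
Local Notation mu2 := (@lebesgue_measure R \x @lebesgue_measure R)%E.

(** The flux is linear in v, hence vanishes outside the support of v, and its divergence integrates
    to zero. *)
Lemma stone_adjP (al be ga : R) :
  is_formal_adjoint (stone al be ga) (stone_adj al be ga).
Proof.
split; first exact: (represents_diff_op (represents_stone_adj al be ga) (N := 2)).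
move=> v w tv tw; have [sv sw] := (tv.1, tw.1).
have [M M0 vM] := test_fun_box tv.
have vk k : box_supported M (vcoord v k).
  move=> x xM; have vx0 := vM x xM.
  by rewrite /vcoord; case: insubP => // i _ _; rewrite /vcomp vx0 mxE.
have sc k := smooth_vcoord k sv; have sd k := smooth_vcoord k sw.
have sF1 : smooth (stone_flux1 be v w).
  exact: smooth_flux1 (sc _) (sc _) (sd _) (sd _) (sd _).
have sF2 : smooth (stone_flux2 be v w).
  exact: smooth_flux2 (sc _) (sc _) (sd _) (sd _) (sd _).
have F1M : box_supported M (stone_flux1 be v w).
  by move=> x xM; rewrite /stone_flux1 /flux1 !vk // !(mul0r, mulr0, addr0).
have F2M : box_supported M (stone_flux2 be v w).
  by move=> x xM; rewrite /stone_flux2 /flux2 !vk // !(mul0r, mulr0, addr0).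
have cD (i : 'I_2) (f : R * R -> R) : smooth f -> continuous (pderiv i f).
  by move=> sf; exact: smooth_continuous (smooth_pderiv i sf).
have DM (i : 'I_2) (f : R * R -> R) : smooth f -> box_supported M f ->
    box_supported (M + 1) (pderiv i f).
  by move=> sf fM; exact: pderiv_box_supported fM (cD i f sf).
have divergence_free : \int[mu2]_x
    (pderiv 0 (stone_flux1 be v w) x + pderiv 1 (stone_flux2 be v w) x) = 0.
  rewrite RintegralD //; last 2 first.
  - exact: box_supported_integrable (cD 0 _ sF1) (DM 0 _ sF1 F1M).
  - exact: box_supported_integrable (cD 1 _ sF2) (DM 1 _ sF2 F2M).
  rewrite (Rintegral_pderiv M0 F1M _ (cD 0 _ sF1)); last first.
    by move=> x; exact: smooth_derivable.
  rewrite (Rintegral_pderiv M0 F2M _ (cD 1 _ sF2)) ?addr0 //.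
  by move=> x; exact: smooth_derivable.
have sSv : vsmooth (stone al be ga v).
  exact: (represents_vsmooth (represents_stone al be ga)).
have sSw : vsmooth (stone_adj al be ga w).
  exact: (represents_vsmooth (represents_stone_adj al be ga)).
have [M' _ wM] := test_fun_box tw.
apply/eqP; rewrite -subr_eq0; apply/eqP.
rewrite /L2_inner -RintegralB //.
- rewrite -[RHS]divergence_free; apply: eq_Rintegral => x _.
  exact: stone_divergence.
(* Here the support of w confines the pairing; in the other pairing it is the support of v. *)
- apply: (@box_supported_integrable _ M'); first exact: continuous_vdot.
  by rewrite vdotC; exact: vdot_box_supported.
- apply: (@box_supported_integrable _ M); first exact: continuous_vdot.
  exact: vdot_box_supported.
Qed.

Lemma formal_adjoint_opP nu (w : vfun (2 + 1)) : vsmooth w ->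
  formal_adjoint (opP nu) w = stone_adj (1 - 2 * nu) (- 2) 0 w.
Proof. by rewrite opPE; exact: formal_adjointE (stone_adjP _ _ _). Qed.

Lemma formal_adjoint_opR nu (w : vfun (2 + 1)) : vsmooth w ->
  formal_adjoint (opR nu) w = stone_adj (2 - 2 * nu) 0 (- 2^-1) w.
Proof. by rewrite opRE; exact: formal_adjointE (stone_adjP _ _ _). Qed.

End StoneFormalAdjoint.

(** * Assembly of the two-sided golden transmutation *)

Theorem theorem4p1 (R : realType) (nu lambda : R)
    (nu_neq_half : nu <> 2^-1) (nu_neq_one : nu <> 1) :
  two_sided_golden_transmutation
    (lame_navier nu) (@vlaplacian R 2)
    (opP nu)
    ((2 * lambda_nu nu) *: formal_adjoint (opR nu) + lambda *: opQhat nu)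
    (opR nu)
    ((2 * lambda_nu nu) *: formal_adjoint (opP nu) + lambda *: @opShat R)
    (opT nu + lambda *: opThat nu)
    (opTtilde nu + lambda *: @opTcheck R).
Proof.
pose Q := (2 * lambda_nu nu) *: formal_adjoint (opR nu) + lambda *: opQhat nu.
pose S := (2 * lambda_nu nu) *: formal_adjoint (opP nu) + lambda *: @opShat R.
have rL := represents_lame nu; have rD := represents_lap R.
have rP := represents_P nu; have rR := represents_R nu.
(* The explicit adjoints agree with the formal ones on smooth functions only, which is all that
   [represents] looks at. *)
have QE w : vsmooth w -> Q w = ((2 * lambda_nu nu) *:
    stone_adj (2 - 2 * nu) 0 (- 2^-1) + lambda *: opQhat nu) w.
  by move=> sw; rewrite /Q !fctE formal_adjoint_opR.
have SE w : vsmooth w -> S w = ((2 * lambda_nu nu) *: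
    stone_adj (1 - 2 * nu) (- 2) 0 + lambda *: @opShat R) w.
  by move=> sw; rewrite /S !fctE formal_adjoint_opP.
have rQ := represents_ext QE (represents_Q nu lambda).
have rS := represents_ext SE (represents_S nu lambda).
have rT := represents_Tsum nu lambda; rewrite scale1r in rT.
have rTt := represents_Ttsum nu lambda; rewrite scale1r in rTt.
have rid n := represents_id R n.
split.
(* The bound N is strict, so 3 admits derivatives up to order two in each variable. *)
- exact: (represents_diff_op rL (N := 3)).
- exact: (represents_diff_op rD (N := 3)).
- exact: (represents_diff_op rP (N := 3)).
- exact: (represents_diff_op rQ (N := 3)).
- exact: (represents_diff_op rR (N := 3)).
- exact: (represents_diff_op rS (N := 3)).
- exact: (represents_diff_op rT (N := 3)).
- exact: (represents_diff_op rTt (N := 3)).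
- move=> v sv.
  apply: (represents_eq (represents_compose rP rL) (represents_compose rD rR) sv).
  by move=> u k x; exact: golden_AP_terms.
- move=> w sw.
  apply: (represents_eq (represents_compose rQ rD) (represents_compose rL rS) sw).
  by move=> u k x; exact: golden_BQ_terms.
- move=> w sw.
  apply: (represents_eq (represents_add (represents_compose rQ rP)
    (represents_compose rL rT)) (rid 3) sw).
  by move=> u k x; exact: golden_PQ_terms.
- move=> w sw.
  apply: (represents_eq (represents_add (represents_compose rS rR)
    (represents_compose rT rL)) (rid 3) sw).
  by move=> u k x; exact: golden_RS_terms.
- move=> v sv.
  apply: (represents_eq (represents_add (represents_compose rP rQ)
    (represents_compose rD rTt)) (rid 2) sv).
  by move=> u k x; exact: golden_QP_terms.
- move=> v sv.
  apply: (represents_eq (represents_add (represents_compose rR rS)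
    (represents_compose rTt rD)) (rid 2) sv).
  by move=> u k x; exact: golden_SR_terms.
Qed.
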